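(* Let $A$ be a Banach algebra, and let $\pi\colon A\mathbin{\widehat\otimes}A\to A$ denote the product map. The following conditions are equivalent: (i) $A$ is biprojective. (ii) There exists a uniform approximate $A$-bimodule morphism $\{\rho_\nu\}$ from $A$ to $A\mathbin{\widehat\otimes}A$ such that $\pi\rho_\nu\to\mathbf 1_A$ in the norm topology.
   Context: Banach algebras are not assumed unital. $\widehat\otimes$ is the completed projective tensor product of Banach spaces; $\pi$ is the bounded linear map with $\pi(a\otimes b)=ab$; $A\mathbin{\widehat\otimes}A$ is a Banach $A$-bimodule via $a\cdot(b\otimes c)=ab\otimes c$, $(b\otimes c)\cdot a=b\otimes ca$. A Banach $A$-bimodule is a Banach space with commuting jointly continuous associative left and right actions of $A$; morphisms are bounded linear bimodule maps. $\mathscr B(X,Y)$ is the space of bounded linear operators; $\mathbf 1_A$ is the identity operator. $A$ is biprojective if $A$ is projective in the category of Banach $A$-bimodules: for each surjective bimodule morphism $\sigma\colon X\to Y$ having a bounded linear right inverse (an admissible epimorphism), every bimodule morphism $A\to Y$ lifts through $\sigma$ to a bimodule morphism $A\to X$. For Banach $A$-bimodules $X,Y$, a uniform approximate $A$-bimodule morphism from $X$ to $Y$ is a net $\{\varphi_\nu\}$ in $\mathscr B(X,Y)$ such that $\varphi_\nu(a\cdot x)-a\cdot\varphi_\nu(x)\to0$ and $\varphi_\nu(x\cdot a)-\varphi_\nu(x)\cdot a\to0$ uniformly on bounded subsets of $A$ and $X$ (i.e. uniformly for $a,x$ ranging over bounded sets). *)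

(* Defs.v *)
From HB Require Import structures.
From mathcomp Require Import all_boot all_order all_algebra.
From mathcomp Require Import complex.
From mathcomp Require Import all_classical all_reals all_analysis.

Set Implicit Arguments.
Unset Strict Implicit.
Unset Printing Implicit Defensive.

Import Order.TTheory GRing.Theory Num.Theory.
Import numFieldNormedType.Exports.

Local Open Scope classical_set_scope.
Local Open Scope ring_scope.
Local Open Scope quotient_scope.
Local Open Scope complex_scope.

Section AlgebraicTensorProduct.
Variables (K : comNzRingType) (E F : lmodType K).

(* A list [:: (a_1, b_1); ...] stands for the finite sum of the a_i (x) b_i;
   scalars are absorbed in the first factor, and [teq] is the congruence generated by the bilinearity relations. *)
Inductive teq : seq (E * F) -> seq (E * F) -> Prop :=
| teq_perm s t : perm_eq s t -> teq s t
| teq_sym s t : teq s t -> teq t s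
| teq_trans s t u : teq s t -> teq t u -> teq s u
| teq_cat s s' t t' : teq s s' -> teq t t' -> teq (s ++ t) (s' ++ t')
| teq_zero b : teq [:: (0, b)] [::]
| teq_addl a a' b : teq [:: (a + a', b)] [:: (a, b); (a', b)]
| teq_addr a b b' : teq [:: (a, b + b')] [:: (a, b); (a, b')]
| teq_scale k a b : teq [:: (k *: a, b)] [:: (a, k *: b)].

Definition teqb (s t : seq (E * F)) : bool := `[< teq s t >].

Lemma teq_refl s : teq s s. Proof. exact: teq_perm. Qed.

Lemma teqb_refl : reflexive teqb.
Proof. by move=> s; apply/asboolP; exact: teq_refl. Qed.

Lemma teqb_sym : symmetric teqb.
Proof. by move=> s t; apply/asboolP/asboolP; exact: teq_sym. Qed.

Lemma teqb_trans : transitive teqb.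
Proof.
by move=> t s u /asboolP st /asboolP tu; apply/asboolP; exact: teq_trans st tu.
Qed.

Canonical teqb_equiv := EquivRel teqb teqb_refl teqb_sym teqb_trans.

Definition atensor : Type := {eq_quot teqb}.

HB.instance Definition _ := Choice.copy atensor {eq_quot teqb}.

Definition fsum (s : seq (E * F)) : atensor := \pi_{eq_quot teqb} s.
Definition frep (x : atensor) : seq (E * F) := repr (x : {eq_quot teqb}).

Lemma frepK x : fsum (frep x) = x. Proof. exact: reprK. Qed.

Definition fscale (k : K) (s : seq (E * F)) := [seq (k *: p.1, p.2) | p <- s].

Lemma atensorW (P : atensor -> Prop) :
  (forall s, P (fsum s)) -> forall x, P x.
Proof. by move=> Ppi x; rewrite -[x]frepK; exact: Ppi. Qed.

Lemma atensorP s t : fsum s = fsum t <-> teq s t.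
Proof. by split=> [/eqmodP/asboolP//|st]; apply/eqmodP/asboolP. Qed.

Lemma teq_catC s t : teq (s ++ t) (t ++ s).
Proof. by apply: teq_perm; rewrite perm_catC. Qed.

Lemma teq_zeror a : teq [:: (a, 0)] [::].
Proof.
apply: (@teq_trans _ [:: (0, 0)]); last exact: teq_zero.
by rewrite -[X in (a, X)](scale0r 0) -[X in (X, 0)](scale0r a);
  apply/teq_sym/teq_scale.
Qed.

Lemma teq_fscale k s t : teq s t -> teq (fscale k s) (fscale k t).
Proof.
elim=> {s t}.
- by move=> s t st; apply: teq_perm; exact: perm_map.
- by move=> s t _; exact: teq_sym.
- by move=> s t u _ st _; exact: teq_trans.
- by move=> s s' t t' _ ss' _ tt'; rewrite /fscale !map_cat; exact: teq_cat.
- by move=> b; rewrite /= scaler0; exact: teq_zero.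
- by move=> a a' b; rewrite /= scalerDr; exact: teq_addl.
- by move=> a b b'; exact: teq_addr.
- by move=> l a b; rewrite /= scalerA mulrC -scalerA; exact: teq_scale.
Qed.

Lemma teq_oppr s : teq (fscale (-1) s ++ s) [::].
Proof.
elim: s => [|[a b] s IH]; first exact: teq_refl.
apply: (@teq_trans _ ([:: (- a, b); (a, b)] ++ (fscale (-1) s ++ s))).
  apply: teq_perm; rewrite /= scaleN1r perm_cons -cat1s perm_catCA.
  exact: perm_refl.
rewrite -[X in teq _ X]cats0; apply: teq_cat => //.
apply: (teq_trans (teq_sym (teq_addl _ _ _))).
by rewrite addNr; exact: teq_zero.
Qed.

Definition atensor_zero : atensor := fsum [::].
Definition atensor_add (x y : atensor) : atensor := fsum (frep x ++ frep y).
Definition atensor_opp (x : atensor) : atensor := fsum (fscale (-1) (frep x)).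
Definition atensor_scale (k : K) (x : atensor) : atensor :=
  fsum (fscale k (frep x)).

Lemma teq_frep s : teq (frep (fsum s)) s.
Proof. by apply/atensorP; rewrite frepK. Qed.

Lemma atensor_addE s t :
  atensor_add (fsum s) (fsum t) = fsum (s ++ t).
Proof. by apply/atensorP/teq_cat; exact: teq_frep. Qed.

Lemma atensor_scaleE k s :
  atensor_scale k (fsum s) = fsum (fscale k s).
Proof. by apply/atensorP/teq_fscale/teq_frep. Qed.

Lemma atensor_oppE s :
  atensor_opp (fsum s) = fsum (fscale (-1) s).
Proof. exact: atensor_scaleE. Qed.

Lemma atensor_addA : associative atensor_add.
Proof.
elim/atensorW=> x; elim/atensorW=> y; elim/atensorW=> z.
by rewrite !atensor_addE catA.
Qed.

Lemma atensor_addC : commutative atensor_add.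
Proof.
elim/atensorW=> x; elim/atensorW=> y; rewrite !atensor_addE.
by apply/atensorP/teq_catC.
Qed.

Lemma atensor_add0 : left_id atensor_zero atensor_add.
Proof. by elim/atensorW=> x; rewrite atensor_addE. Qed.

Lemma atensor_addN : left_inverse atensor_zero atensor_opp atensor_add.
Proof.
elim/atensorW=> x; rewrite atensor_oppE atensor_addE.
by apply/atensorP/teq_oppr.
Qed.

HB.instance Definition _ := GRing.isZmodule.Build atensor
  atensor_addA atensor_addC atensor_add0 atensor_addN.

Lemma fsumD s t : fsum s + fsum t = fsum (s ++ t).
Proof. exact: atensor_addE. Qed.

Lemma atensor_scaleA k l x :
  atensor_scale k (atensor_scale l x) = atensor_scale (k * l) x.
Proof.
elim/atensorW: x => s; rewrite !atensor_scaleE; congr fsum.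
by rewrite /fscale -map_comp; apply: eq_map => p /=; rewrite scalerA.
Qed.

Lemma atensor_scale1 : left_id 1 atensor_scale.
Proof.
elim/atensorW=> x; rewrite !atensor_scaleE; congr fsum.
by rewrite /fscale -[RHS]map_id; apply: eq_map => -[a b] /=; rewrite scale1r.
Qed.

Lemma atensor_scaleDr : right_distributive atensor_scale +%R.
Proof.
move=> k; elim/atensorW=> x; elim/atensorW=> y.
by rewrite !(fsumD, atensor_scaleE) /fscale map_cat.
Qed.

Lemma atensor_scaleDl x : {morph atensor_scale^~ x : k l / k + l}.
Proof.
elim/atensorW: x => s k l.
rewrite !atensor_scaleE fsumD; apply/atensorP.
elim: s => [|[a b] s IH]; first exact: teq_refl.
apply: (@teq_trans _ ([:: (k *: a, b); (l *: a, b)] ++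
    (fscale k s ++ fscale l s))).
  rewrite /= scalerDl; apply: (@teq_cat [:: _] [:: _; _]) => //.
  exact: teq_addl.
apply: teq_perm; rewrite /= perm_cons -[X in perm_eq X _]cat1s perm_catCA.
exact: perm_refl.
Qed.

HB.instance Definition _ := GRing.Zmodule_isLmodule.Build K atensor
  atensor_scaleA atensor_scale1 atensor_scaleDr atensor_scaleDl.

Lemma fsumZ k s : k *: fsum s = fsum (fscale k s).
Proof. exact: atensor_scaleE. Qed.

Definition atens (a : E) (b : F) : atensor := fsum [:: (a, b)].

Lemma fsum_atens s : fsum s = \sum_(p <- s) atens p.1 p.2.
Proof.
elim: s => [|[a b] s IH]; first by rewrite big_nil.
by rewrite big_cons -IH fsumD.
Qed.

Lemma atens_frep x : x = \sum_(p <- frep x) atens p.1 p.2.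
Proof. by rewrite -fsum_atens frepK. Qed.

Lemma atens_linearl b : linear (atens^~ b).
Proof.
move=> k a a'; rewrite /atens [X in _ = X]/GRing.add /GRing.scale /=.
by rewrite atensor_scaleE atensor_addE; apply/atensorP/teq_addl.
Qed.

Lemma atens_linearr a : linear (atens a).
Proof.
move=> k b b'; rewrite /atens fsumZ fsumD; apply/atensorP.
apply: (teq_trans (teq_addr _ _ _)).
apply: (@teq_cat [:: _] [:: _] [:: _] [:: _]); last exact: teq_refl.
exact/teq_sym/teq_scale.
Qed.

Lemma atens_bilinear : bilinear_for *:%R *:%R atens.
Proof. by split=> [b|a]; [exact: atens_linearl|exact: atens_linearr]. Qed.

HB.instance Definition _ :=
  bilinear_isBilinear.Build K E F atensor _ _ atens atens_bilinear.

(* The linear map on E (x) F induced by a bilinear map. *)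
Definition alift (Z : lmodType K) (B : E -> F -> Z) (x : atensor) : Z :=
  \sum_(p <- frep x) B p.1 p.2.

Section alift.
Variables (Z : lmodType K) (B : {bilinear E -> F -> Z}).

Let ev (s : seq (E * F)) : Z := \sum_(p <- s) B p.1 p.2.

Let ev_teq s t : teq s t -> ev s = ev t.
Proof.
elim=> {s t}; rewrite /ev.
- by move=> s t st; exact: perm_big.
- by move=> s t _ ->.
- by move=> s t u _ -> _ ->.
- by move=> s s' t t' _ ss' _ tt'; rewrite !big_cat /= ss' tt'.
- by move=> b; rewrite big_seq1 big_nil /= linear0l.
- by move=> a a' b; rewrite !big_cons big_nil /= addr0 linearDl addr0.
- by move=> a b b'; rewrite !big_cons big_nil /= addr0 linearDr addr0.
- by move=> k a b; rewrite !big_seq1 /= linearZl_LR linearZr.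
Qed.

Lemma alift_fsum s : alift B (fsum s) = \sum_(p <- s) B p.1 p.2.
Proof. exact/ev_teq/teq_frep. Qed.

Lemma alift_sum s :
  alift B (\sum_(p <- s) atens p.1 p.2) = \sum_(p <- s) B p.1 p.2.
Proof. by rewrite -fsum_atens alift_fsum. Qed.

Lemma alift_atens a b : alift B (atens a b) = B a b.
Proof. by rewrite alift_fsum big_seq1. Qed.

Lemma alift_linear : linear (alift B).
Proof.
move=> k; elim/atensorW=> x; elim/atensorW=> y.
rewrite fsumZ fsumD !alift_fsum big_cat /=; congr (_ + _).
rewrite big_map scaler_sumr; apply: eq_bigr => p _ /=.
by rewrite linearZl_LR.
Qed.

End alift.

End AlgebraicTensorProduct.

Section Completion.
Variables (R : realType) (V : lmodType R[i]).

(* Norms of complex normed modules are valued in R[i]; rnorm is the same norm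
   as a real number. *)
Definition rnorm (W : normedZmodType R[i]) (x : W) : R := complex.Re `|x|.

Record seminorm := Seminorm {
  seminorm_val :> V -> R;
  seminormD : forall x y, seminorm_val (x + y) <= seminorm_val x + seminorm_val y;
  seminormZ : forall (k : R[i]) x,
    seminorm_val (k *: x) = rnorm k * seminorm_val x }.

Variable p : seminorm.

Lemma rnormE (W : normedZmodType R[i]) (x : W) : (rnorm x)%:C = `|x|.
Proof. by rewrite /rnorm RRe_real// ger0_real. Qed.

Lemma rnorm_ge0 (W : normedZmodType R[i]) (x : W) : 0 <= rnorm x.
Proof. by rewrite -lecR rnormE; exact: normr_ge0. Qed.

Lemma seminorm0 : p 0 = 0.
Proof. by rewrite -(scale0r 0) seminormZ /rnorm normr0 mul0r. Qed.

Lemma seminormN x : p (- x) = p x.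
Proof. by rewrite -scaleN1r seminormZ /rnorm normrN normr1 mul1r. Qed.

Lemma seminorm_ge0 x : 0 <= p x.
Proof.
have := seminormD p x (- x); rewrite subrr seminorm0 seminormN.
by rewrite -mulr2n pmulrn_lge0.
Qed.

Lemma seminormB x y : p (x - y) <= p x + p y.
Proof. by rewrite -[p y]seminormN; exact: seminormD. Qed.

Lemma seminorm_distC x y : p (x - y) = p (y - x).
Proof. by rewrite -seminormN opprB. Qed.

Lemma seminorm_tri y x z : p (x - z) <= p (x - y) + p (y - z).
Proof. by apply: le_trans (seminormD _ _ _); rewrite addrA subrK. Qed.

Lemma seminorm_dist x y : `|p x - p y| <= p (x - y).
Proof.
have le_p a b : p a - p b <= p (a - b).
  by rewrite lerBlDr (le_trans _ (seminormD _ _ _))// subrK.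
by rewrite ler_norml le_p andbT lerNl opprB seminorm_distC le_p.
Qed.

Definition cauchy_seq (u : nat -> V) :=
  forall e : R, 0 < e -> exists N : nat, forall m n : nat,
    (N <= m)%N -> (N <= n)%N -> p (u m - u n) < e.

Definition cseq := {u : nat -> V | `[< cauchy_seq u >]}.

Definition ceq (u v : cseq) : bool :=
  `[< (fun n => p (val u n - val v n)) @ \oo --> (0 : R) >].

Lemma cauchy_cseq (u : cseq) : cauchy_seq (val u).
Proof. exact/asboolP/(valP u). Qed.

Lemma ceq_refl : reflexive ceq.
Proof.
move=> u; apply/asboolP; under eq_fun do rewrite subrr seminorm0.
exact: cvg_cst.
Qed.

Lemma ceq_sym : symmetric ceq.
Proof.
move=> u v; apply/asboolP/asboolP; under eq_fun do rewrite seminorm_distC.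
all: by [].
Qed.

Lemma squeeze0 (f g : nat -> R) : (forall n, 0 <= f n <= g n) ->
  g @ \oo --> (0 : R) -> f @ \oo --> (0 : R).
Proof.
move=> fg g0; apply: (squeeze_cvgr _ (cvg_cst 0) g0).
exact: nearW.
Qed.

Lemma ceq_trans : transitive ceq.
Proof.
move=> v u w /asboolP uv /asboolP vw; apply/asboolP.
apply: squeeze0; last by rewrite -[0](addr0 0); exact: cvgD uv vw.
by move=> n; rewrite seminorm_ge0/=; exact: seminorm_tri.
Qed.

Canonical ceq_equiv := EquivRel ceq ceq_refl ceq_sym ceq_trans.

(* Cauchy sequences modulo null sequences: the Hausdorff completion. *)
Definition completion : Type := {eq_quot ceq}.

HB.instance Definition _ := Choice.copy completion {eq_quot ceq}.

Definition climit (u : cseq) : completion := \pi_{eq_quot ceq} u.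
Definition crep (x : completion) : cseq := repr (x : {eq_quot ceq}).

Lemma crepK x : climit (crep x) = x. Proof. exact: reprK. Qed.

Lemma climitP u v : climit u = climit v <->
  (fun n => p (val u n - val v n)) @ \oo --> (0 : R).
Proof. by split=> [/eqmodP/asboolP//|st]; apply/eqmodP/asboolP. Qed.

Lemma crep_climit u :
  (fun n => p (val (crep (climit u)) n - val u n)) @ \oo --> (0 : R).
Proof. by apply/climitP; rewrite crepK. Qed.

Lemma completionW (P : completion -> Prop) :
  (forall u, P (climit u)) -> forall x, P x.
Proof. by move=> Ppi x; rewrite -[x]crepK; exact: Ppi. Qed.

Lemma cauchy_cst v : cauchy_seq (fun=> v).
Proof. by move=> e e0; exists 0 => *; rewrite subrr seminorm0. Qed.

Lemma cauchy_add u v :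
  cauchy_seq u -> cauchy_seq v -> cauchy_seq (fun n => u n + v n).
Proof.
move=> cu cv e e0; have e20 : 0 < e / 2 by rewrite divr_gt0.
have [N uN] := cu _ e20; have [M vM] := cv _ e20.
exists (maxn N M) => m n; rewrite !geq_max => /andP[Nm Mm] /andP[Nn Mn].
rewrite opprD addrACA (le_lt_trans (seminormD _ _ _))// [ltRHS]splitr.
by rewrite ltrD ?uN ?vM.
Qed.

Lemma cauchy_scale k u : cauchy_seq u -> cauchy_seq (fun n => k *: u n).
Proof.
move=> cu e e0; have k1 : 0 < rnorm k + 1 by rewrite ltr_wpDl ?rnorm_ge0.
have [N uN] := cu (e / (rnorm k + 1)) (divr_gt0 e0 k1).
exists N => m n Nm Nn; rewrite -scalerBr seminormZ.
apply: (@le_lt_trans _ _ ((rnorm k + 1) * p (u m - u n))).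
  by rewrite ler_wpM2r ?seminorm_ge0// lerDl.
by rewrite mulrC -ltr_pdivlMr ?uN.
Qed.

Definition mkcseq u (cu : cauchy_seq u) : cseq := Sub u (asboolT cu).

Definition completion_zero : completion := climit (mkcseq (cauchy_cst 0)).
Definition completion_add (x y : completion) : completion :=
  climit (mkcseq (cauchy_add (cauchy_cseq (crep x)) (cauchy_cseq (crep y)))).
Definition completion_scale (k : R[i]) (x : completion) : completion :=
  climit (mkcseq (cauchy_scale k (cauchy_cseq (crep x)))).
Definition completion_opp (x : completion) : completion :=
  completion_scale (-1) x.

Lemma climit_add u v (cu : cauchy_seq u) (cv : cauchy_seq v) :
  completion_add (climit (mkcseq cu)) (climit (mkcseq cv)) =
  climit (mkcseq (cauchy_add cu cv)).
Proof.
apply/climitP => /=.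
apply: (@squeeze0 _ (fun n => p (val (crep (climit (mkcseq cu))) n - u n) +
  p (val (crep (climit (mkcseq cv))) n - v n))).
  by move=> n; rewrite seminorm_ge0/= opprD addrACA seminormD.
by rewrite -[0](addr0 0); apply: cvgD; exact: crep_climit.
Qed.

Lemma climit_scale k u (cu : cauchy_seq u) :
  completion_scale k (climit (mkcseq cu)) =
  climit (mkcseq (cauchy_scale k cu)).
Proof.
apply/climitP => /=; under eq_fun do rewrite -scalerBr seminormZ.
by rewrite -[0](mulr0 (rnorm k)); apply: cvgMr; exact: crep_climit.
Qed.

Lemma climit_eq u v (cu : cauchy_seq u) (cv : cauchy_seq v) :
  (forall n, u n = v n) -> climit (mkcseq cu) = climit (mkcseq cv).
Proof.
move=> uv; apply/climitP => /=; under eq_fun do rewrite uv subrr seminorm0.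
exact: cvg_cst.
Qed.

Lemma completionP (P : completion -> Prop) :
  (forall u (cu : cauchy_seq u), P (climit (mkcseq cu))) -> forall x, P x.
Proof.
move=> Pu; elim/completionW => u.
suff -> : u = mkcseq (cauchy_cseq u) by exact: Pu.
exact: val_inj.
Qed.

Lemma completion_addA : associative completion_add.
Proof.
elim/completionP=> u cu; elim/completionP=> v cv; elim/completionP=> w cw.
by rewrite !climit_add; apply: climit_eq => n /=; rewrite addrA.
Qed.

Lemma completion_addC : commutative completion_add.
Proof.
elim/completionP=> u cu; elim/completionP=> v cv.
by rewrite !climit_add; apply: climit_eq => n /=; rewrite addrC.
Qed.

Lemma completion_add0 : left_id completion_zero completion_add.
Proof.
elim/completionP=> u cu.
by rewrite !climit_add; apply: climit_eq => n /=; rewrite add0r.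
Qed.

Lemma completion_addN :
  left_inverse completion_zero completion_opp completion_add.
Proof.
elim/completionP=> u cu; rewrite /completion_opp climit_scale climit_add.
by apply: climit_eq => n /=; rewrite scaleN1r addNr.
Qed.

HB.instance Definition _ := GRing.isZmodule.Build completion
  completion_addA completion_addC completion_add0 completion_addN.

Lemma climitD u v (cu : cauchy_seq u) (cv : cauchy_seq v) :
  climit (mkcseq cu) + climit (mkcseq cv) = climit (mkcseq (cauchy_add cu cv)).
Proof. exact: climit_add. Qed.

Lemma completion_scaleA k l x :
  completion_scale k (completion_scale l x) = completion_scale (k * l) x.
Proof.
elim/completionP: x => u cu; rewrite !climit_scale.
by apply: climit_eq => n /=; rewrite scalerA.
Qed.

Lemma completion_scale1 : left_id 1 completion_scale.
Proof.
elim/completionP=> u cu; rewrite !climit_scale.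
by apply: climit_eq => n /=; rewrite scale1r.
Qed.

Lemma completion_scaleDr : right_distributive completion_scale +%R.
Proof.
move=> k; elim/completionP=> u cu; elim/completionP=> v cv.
rewrite !(climit_scale, climitD).
by apply: climit_eq => n /=; rewrite scalerDr.
Qed.

Lemma completion_scaleDl x : {morph completion_scale^~ x : k l / k + l}.
Proof.
elim/completionP: x => u cu k l; rewrite !(climit_scale, climitD).
by apply: climit_eq => n /=; rewrite scalerDl.
Qed.

HB.instance Definition _ := GRing.Zmodule_isLmodule.Build R[i] completion
  completion_scaleA completion_scale1 completion_scaleDr completion_scaleDl.

Lemma climitZ k u (cu : cauchy_seq u) :
  k *: climit (mkcseq cu) = climit (mkcseq (cauchy_scale k cu)).
Proof. exact: climit_scale. Qed.

Definition cnorm (x : completion) : R := lim ((p \o val (crep x)) @ \oo).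

Lemma seminorm_cauchy_cvg u : cauchy_seq u -> cvgn (p \o u).
Proof.
move=> cu; apply/cauchy_cvgP/cauchy_exP => e e0.
have [N uN] := cu e e0; exists (p (u N)), N => // n /= Nn.
rewrite -ball_normE /= (le_lt_trans (seminorm_dist _ _))//.
exact: uN.
Qed.

Lemma cnormE u (cu : cauchy_seq u) :
  cnorm (climit (mkcseq cu)) = lim ((p \o u) @ \oo).
Proof.
set v := crep (climit (mkcseq cu)).
have cv : cvgn (p \o val v) by exact/seminorm_cauchy_cvg/cauchy_cseq.
have cu' := seminorm_cauchy_cvg cu.
apply/eqP; rewrite -subr_eq0 /cnorm -/v -limB//; apply/eqP/cvg_lim => //.
apply: norm_cvg0.
apply: (@squeeze0 _ (fun n => p (val v n - u n))); last exact: crep_climit.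
by move=> n; rewrite normr_ge0 /= seminorm_dist.
Qed.

Lemma cvg_cnorm u (cu : cauchy_seq u) :
  (p \o u) @ \oo --> cnorm (climit (mkcseq cu)).
Proof. by rewrite cnormE; exact: seminorm_cauchy_cvg. Qed.

Lemma cnormD x y : cnorm (x + y) <= cnorm x + cnorm y.
Proof.
elim/completionP: x => u cu; elim/completionP: y => v cv; rewrite climitD.
have cD : (fun n => p (u n) + p (v n)) @ \oo -->
    cnorm (climit (mkcseq cu)) + cnorm (climit (mkcseq cv)).
  by apply: cvgD; exact: cvg_cnorm.
apply: (ler_cvg_to (@cvg_cnorm _ (cauchy_add cu cv)) cD).
by apply: nearW => n; exact: seminormD.
Qed.

Lemma cnormZ k x : cnorm (k *: x) = rnorm k * cnorm x.
Proof.
elim/completionP: x => u cu; rewrite climitZ cnormE; apply/cvg_lim => //.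
rewrite /comp/=; under eq_fun do rewrite seminormZ.
by apply: cvgMr; exact: cvg_cnorm.
Qed.

Lemma cnorm0_eq0 x : cnorm x = 0 -> x = 0.
Proof.
elim/completionP: x => u cu u0; apply/climitP => /=.
under eq_fun do rewrite subr0.
by rewrite -u0; exact: cvg_cnorm.
Qed.

Let cnormC (x : completion) : R[i] := (cnorm x)%:C.

Let cnormCD x y : cnormC (x + y) <= cnormC x + cnormC y.
Proof. by rewrite /cnormC -rmorphD lecR cnormD. Qed.

Let cnormCZ k x : cnormC (k *: x) = `|k| * cnormC x.
Proof. by rewrite /cnormC cnormZ rmorphM /= rnormE. Qed.

Let cnormC0_eq0 x : cnormC x = 0 -> x = 0.
Proof. by move=> /(congr1 (@complex.Re R)); exact: cnorm0_eq0. Qed.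

HB.instance Definition _ := @Lmodule_isNormed.Build R[i] completion
  cnormC cnormCD cnormCZ cnormC0_eq0.

Lemma rnorm_completion (x : completion) : rnorm x = cnorm x. Proof. by []. Qed.

Definition to_completion (v : V) : completion := climit (mkcseq (cauchy_cst v)).

Lemma to_completion_linear : linear to_completion.
Proof. by move=> k u v; rewrite /to_completion climitZ climitD; exact: climit_eq. Qed.

HB.instance Definition _ :=
  GRing.isLinear.Build R[i] V completion _ to_completion to_completion_linear.

Lemma rnorm_to_completion v : rnorm (to_completion v) = p v.
Proof. by rewrite rnorm_completion cnormE; apply: (@lim_cst R^o). Qed.

Lemma rnorm_climitB u (cu : cauchy_seq u) (e : R) : 0 < e ->
  exists N : nat, forall n : nat, (N <= n)%N ->
    rnorm (climit (mkcseq cu) - to_completion (u n)) <= e.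
Proof.
move=> e0; have [N uN] := cu e e0; exists N => n Nn.
rewrite -linearN /to_completion /= climitD rnorm_completion.
set c := cauchy_add _ _.
have lec : (fun=> e) @ \oo --> e by exact: cvg_cst.
apply: (ler_cvg_to (@cvg_cnorm _ c) lec).
by exists N => // m /= Nm; exact/ltW/uN.
Qed.

Lemma completion_dense (x : completion) (e : R) : 0 < e ->
  exists v, rnorm (x - to_completion v) < e.
Proof.
move=> e0; elim/completionP: x => u cu.
have [N uN] := @rnorm_climitB u cu (e / 2) (divr_gt0 e0 (ltr0Sn _ 1)).
exists (u N); apply: le_lt_trans (uN N (leqnn N)) _.
by rewrite ltr_pdivrMr// mulr_natr mulr2n ltrDl.
Qed.

Lemma rnorm_tri (W : normedZmodType R[i]) (y x z : W) :
  rnorm (x - z) <= rnorm (x - y) + rnorm (y - z).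
Proof. by rewrite -lecR rmorphD /= !rnormE ler_distD. Qed.

Lemma rnorm_distC (W : normedZmodType R[i]) (x y : W) :
  rnorm (x - y) = rnorm (y - x).
Proof. by rewrite /rnorm distrC. Qed.

Lemma gt0_complexE (e : R[i]) : 0 < e -> exists2 d : R, 0 < d & e = d%:C.
Proof.
move=> e0; exists (complex.Re e); last by rewrite RRe_real// gtr0_real.
by rewrite -ltcR RRe_real// gtr0_real.
Qed.

Lemma completion_complete (F : set_system completion) :
  ProperFilter F -> cauchy F -> cvg F.
Proof.
move=> FF /cauchyP cF.
pose r (n : nat) : R := n.+1%:R^-1.
have r0 n : 0 < r n by rewrite invr_gt0.
have rcvg (e : R) : 0 < e -> exists N, forall n, (N <= n)%N -> r n < e.
  move=> e0; have [N _ H] := near_infty_natSinv_lt (PosNum e0).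
  by exists N => n; exact: H.
have /choice[v vF] : forall n, exists v : V,
    F [set y : completion | rnorm (to_completion v - y) < r n].
  move=> n; have r20 : 0 < r n / 2 by rewrite divr_gt0.
  have [|x xF] := cF (r n / 2)%:C; first by rewrite ltcR.
  have [v xv] := completion_dense x r20; exists v.
  apply: filterS xF => y; rewrite -ball_normE /= -rnormE ltcR => xy.
  apply: (le_lt_trans (rnorm_tri x _ _)).
  by rewrite rnorm_distC [ltRHS]splitr ltrD.
have cv : cauchy_seq v.
  move=> e e0; have [N rN] := rcvg (e / 2) (divr_gt0 e0 (ltr0Sn _ 1)).
  exists N => m n Nm Nn.
  have [y [/= my ny]] := filter_ex (filterI (vF m) (vF n)).
  rewrite -rnorm_to_completion linearB /= (le_lt_trans (rnorm_tri y _ _))//.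
  rewrite [ltRHS]splitr ltrD//; first exact: lt_trans my (rN _ Nm).
  by rewrite rnorm_distC; exact: lt_trans ny (rN _ Nn).
apply/cvg_ex; exists (climit (mkcseq cv)); apply/cvgrPdist_lt => eps eps0.
have [e e0 ->] := gt0_complexE eps0; have e20 : 0 < e / 2 by rewrite divr_gt0.
have [N rN] := rcvg _ e20; have [M vM] := rnorm_climitB cv e20.
apply: filterS (vF (maxn N M)) => y vy; rewrite -rnormE ltcR.
apply: (le_lt_trans (rnorm_tri (to_completion (v (maxn N M))) _ _)).
rewrite [ltRHS]splitr ler_ltD ?vM ?leq_maxr//.
by apply: lt_trans vy _; rewrite rN// leq_maxl.
Qed.

HB.instance Definition _ :=
  Uniform_isComplete.Build completion completion_complete.

End Completion.

Section CompletionExtension.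
Variables (R : realType) (V : lmodType R[i]) (p : seminorm V).
Variable (Z : completeNormedModType R[i]).

(* The extension to the completion, by continuity, of a map defined on V. *)
Definition cext (L : V -> Z) (x : completion p) : Z :=
  lim ((L \o val (crep x)) @ \oo).

Variables (L : {linear V -> Z}) (M : R).
Hypothesis LM : forall v, rnorm (L v) <= M * p v.

Lemma cvg0_rnorm (f : nat -> Z) :
  (fun n => rnorm (f n)) @ \oo --> (0 : R) -> f @ \oo --> (0 : Z).
Proof.
move=> f0; apply/cvgr0Pnorm_lt => eps eps0; have [e e0 ->] := gt0_complexE eps0.
move/cvgr0Pnorm_lt : f0 => /(_ e e0); apply: filterS => n.
by rewrite -rnormE ltcR ger0_norm// rnorm_ge0.
Qed.

Lemma cext_cvg_cauchy u : cauchy_seq p u -> cvgn (L \o u).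
Proof.
move=> cu; apply/cauchy_cvgP/cauchyP => eps eps0.
have [e e0 ->] := gt0_complexE eps0.
have M0 : 0 < `|M| + 1 by rewrite ltr_wpDl.
have [N uN] := cu (e / (`|M| + 1)) (divr_gt0 e0 M0).
exists (L (u N)), N => // n /= Nn; rewrite -ball_normE /= -linearB -rnormE ltcR.
apply: (le_lt_trans (LM _)).
apply: (@le_lt_trans _ _ ((`|M| + 1) * p (u N - u n))).
  by rewrite ler_wpM2r ?seminorm_ge0// (le_trans (ler_norm _))// lerDl.
by rewrite mulrC -ltr_pdivlMr// uN.
Qed.

Lemma cext_climit u (cu : cauchy_seq p u) :
  cext L (climit (mkcseq cu)) = lim ((L \o u) @ \oo).
Proof.
set v := crep (climit (mkcseq cu)).
have cLv : cvgn (L \o val v) by exact/cext_cvg_cauchy/cauchy_cseq.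
have cLu := cext_cvg_cauchy cu.
apply/eqP; rewrite -subr_eq0 /cext -/v -limB//; apply/eqP/cvg_lim => //.
apply: cvg0_rnorm.
have vu : (fun n => M * p (val v n - u n)) @ \oo --> (0 : R).
  by rewrite -[0](mulr0 M); apply: cvgMr; exact: crep_climit.
apply: squeeze0 vu => n; rewrite rnorm_ge0 /=.
by apply: le_trans (LM _); rewrite linearB.
Qed.

Lemma cvg_cext u (cu : cauchy_seq p u) :
  (L \o u) @ \oo --> cext L (climit (mkcseq cu)).
Proof. by rewrite cext_climit; exact: cext_cvg_cauchy. Qed.

Lemma cext_linear : linear (cext L).
Proof.
move=> k; elim/completionP=> u cu; elim/completionP=> v cv.
rewrite climitZ climitD !cext_climit; apply/cvg_lim => //.
rewrite (_ : _ \o _ = (fun n => k *: L (u n) + L (v n))); last first.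
  by apply/funext => n /=; rewrite linearP.
by apply: cvgD; [apply: cvgZr|]; exact: cext_cvg_cauchy.
Qed.

Lemma cext_to_completion v : cext L (to_completion p v) = L v.
Proof. by rewrite cext_climit; apply: lim_cst. Qed.

Lemma cext_bound x : rnorm (cext L x) <= M * rnorm x.
Proof.
elim/completionP: x => u cu.
have c1 : (fun n => rnorm (L (u n))) @ \oo -->
    rnorm (cext L (climit (mkcseq cu))).
  apply/cvgrPdist_lt => e e0.
  have /cvgrPdist_lt/(_ e%:C) := @cvg_cext _ cu.
  rewrite ltcR => /(_ e0); apply: filterS => n; rewrite -rnormE ltcR.
  apply: le_lt_trans.
  have tri (a b : Z) : rnorm a - rnorm b <= rnorm (a - b).
    by rewrite lerBlDr; have := rnorm_tri b a 0; rewrite !subr0.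
  by rewrite ler_norml tri andbT lerNl opprB rnorm_distC tri.
have c2 : (fun n => M * p (u n)) @ \oo --> M * rnorm (climit (mkcseq cu)).
  by apply: cvgMr; exact: (@cvg_cnorm _ _ p _ cu).
by apply: (ler_cvg_to c1 c2); apply: nearW => n; exact: LM.
Qed.

End CompletionExtension.

Lemma bounded_linearP (R : realType) (V W : normedModType R[i])
    (f : {linear V -> W}) :
  (exists M : R, forall x, rnorm (f x) <= M * rnorm x) <-> continuous f.
Proof.
rewrite -linear_bounded_continuous linear_boundedP; split.
  move=> [M fM]; near=> r => x.
  have r0 : M%:C <= r by near: r; apply: nbhs_pinfty_ge; rewrite realE !lecR le_total.
  apply: (@le_trans _ _ (M%:C * `|x|)); last by rewrite ler_wpM2r.
  by rewrite -!rnormE -rmorphM lecR.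
move=> [r [rr fr]]; have r1 : r + 1 > r by rewrite ltrDl.
exists (complex.Re (r + 1)) => x; rewrite -lecR rmorphM /= !rnormE.
by rewrite RRe_real ?realD//; exact: fr.
Unshelve. all: by end_near. Qed.

Section ProjectiveTensorProduct.
Variables (R : realType) (E F : normedModType R[i]).

Definition tmass (s : seq (E * F)) : R :=
  \sum_(q <- s) rnorm q.1 * rnorm q.2.

Definition projective_norm (x : atensor E F) : R :=
  inf [set tmass s | s in [set s | x = \sum_(q <- s) atens q.1 q.2]].

Lemma tmass_ge0 s : 0 <= tmass s.
Proof. by apply: sumr_ge0 => q _; rewrite mulr_ge0 ?rnorm_ge0. Qed.

Let has_inf_proj x :
  has_inf [set tmass s | s in [set s | x = \sum_(q <- s) atens q.1 q.2]].
Proof.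
split; first by exists (tmass (frep x)), (frep x) => //=; exact: atens_frep.
by exists 0 => _ [s _ <-]; exact: tmass_ge0.
Qed.

Lemma projective_norm_le x s :
  x = \sum_(q <- s) atens q.1 q.2 -> projective_norm x <= tmass s.
Proof. by move=> xs; apply: ge_inf; [case: (has_inf_proj x)|exists s]. Qed.

Lemma projective_norm_lt x (e : R) : 0 < e -> exists2 s,
  x = \sum_(q <- s) atens q.1 q.2 & tmass s < projective_norm x + e.
Proof.
move=> e0; have [_ [s xs <-] se] := inf_adherent e0 (has_inf_proj x).
by exists s.
Qed.

Lemma projective_norm_ge x (c : R) :
  (forall s, x = \sum_(q <- s) atens q.1 q.2 -> c <= tmass s) ->
  c <= projective_norm x.
Proof.
move=> cs; apply: lb_le_inf; first by case: (has_inf_proj x).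
by move=> _ [s xs <-]; exact: cs.
Qed.

Lemma projective_normD x y :
  projective_norm (x + y) <= projective_norm x + projective_norm y.
Proof.
rewrite -lerBlDr; apply: projective_norm_ge => s xs.
rewrite lerBlDr -lerBlDl; apply: projective_norm_ge => t yt.
rewrite lerBlDl; apply: (le_trans (@projective_norm_le _ (s ++ t) _)).
  by rewrite big_cat /= -xs -yt.
by rewrite /tmass big_cat.
Qed.

Let projective_normZ_le k x :
  projective_norm (k *: x) <= rnorm k * projective_norm x.
Proof.
have [->|k0] := eqVneq k 0.
  rewrite scale0r /rnorm normr0 mul0r.
  have := @projective_norm_le 0 [::]; rewrite /tmass !big_nil; exact.
have rk0 : 0 < rnorm k by rewrite -ltcR rnormE normr_gt0.
rewrite -ler_pdivrMl//; apply: projective_norm_ge => s xs.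
rewrite ler_pdivrMl//.
apply: (le_trans (@projective_norm_le _ (fscale k s) _)).
  rewrite xs scaler_sumr big_map; apply: eq_bigr => q _ /=.
  by rewrite linearZl_LR.
rewrite /tmass big_map mulr_sumr; apply: ler_sum => q _ /=.
by rewrite mulrA ler_wpM2r ?rnorm_ge0// -lecR rmorphM /= !rnormE normrZ.
Qed.

Lemma projective_normZ (k : R[i]) x :
  projective_norm (k *: x) = rnorm k * projective_norm x.
Proof.
have [->|k0] := eqVneq k 0.
  apply/eqP; rewrite eq_le projective_normZ_le /= /rnorm normr0 mul0r.
  by apply: projective_norm_ge => s _; exact: tmass_ge0.
have rk0 : 0 < rnorm k by rewrite -ltcR rnormE normr_gt0.
apply/eqP; rewrite eq_le projective_normZ_le /= -ler_pdivlMl//.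
rewrite -[X in projective_norm X <= _](scalerK k0).
apply: (le_trans (projective_normZ_le _ _)); rewrite ler_wpM2r//.
  by apply: projective_norm_ge => s _; exact: tmass_ge0.
by rewrite -lecR rnormE normfV fmorphV /= rnormE.
Qed.

Definition projective_seminorm : seminorm (atensor E F) :=
  Seminorm projective_normD projective_normZ.

Local Notation ptensor := (completion projective_seminorm).

Definition tens (a : E) (b : F) : ptensor :=
  to_completion projective_seminorm (atens a b).

Lemma tens_linearl b : linear (tens^~ b).
Proof. by move=> k a a'; rewrite /tens atens_linearl linearP. Qed.

Lemma tens_linearr a : linear (tens a).
Proof. by move=> k b b'; rewrite /tens atens_linearr linearP. Qed.

Lemma tens_bilinear : bilinear_for *:%R *:%R tens.
Proof. by split=> [b|a]; [exact: tens_linearl|exact: tens_linearr]. Qed.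

HB.instance Definition _ :=
  bilinear_isBilinear.Build R[i] E F ptensor _ _ tens tens_bilinear.

Lemma rnorm_tens a b : rnorm (tens a b) <= rnorm a * rnorm b.
Proof.
rewrite rnorm_to_completion.
apply: (le_trans (@projective_norm_le _ [:: (a, b)] _)); rewrite ?big_seq1//.
by rewrite /tmass big_seq1.
Qed.

Lemma ptensor_dense (x : ptensor) (e : R) : 0 < e ->
  exists s : seq (E * F), rnorm (x - \sum_(q <- s) tens q.1 q.2) < e.
Proof.
move=> e0; have [v xv] := completion_dense x e0; exists (frep v).
by move: xv; rewrite {1}[v]atens_frep linear_sum.
Qed.

Lemma ptensor_ext (Z : normedModType R[i]) (f g : ptensor -> Z) :
  linear f -> linear g ->
  (exists M : R, forall x, rnorm (f x) <= M * rnorm x) ->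
  (exists M : R, forall x, rnorm (g x) <= M * rnorm x) ->
  (forall a b, f (tens a b) = g (tens a b)) -> f =1 g.
Proof.
move=> lf lg [M fM] [N gN] fg x.
pose f' : {linear ptensor -> Z} := HB.pack f (GRing.isLinear.Build _ _ _ _ f lf).
pose g' : {linear ptensor -> Z} := HB.pack g (GRing.isLinear.Build _ _ _ _ g lg).
rewrite -[f]/(f' : _ -> _) -[g]/(g' : _ -> _).
have {fM} fM : forall x, rnorm (f' x) <= M * rnorm x := fM.
have {gN} gN : forall x, rnorm (g' x) <= N * rnorm x := gN.
have {fg} fg : forall a b, f' (tens a b) = g' (tens a b) := fg.
move: f' g' fM gN fg => {lf lg}{}f {}g fM gN fg.
apply/eqP; rewrite -subr_eq0 -normr_eq0 -rnormE; apply/eqP; congr (_%:C).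
apply/eqP; rewrite eq_le rnorm_ge0 andbT; apply/ler_addgt0Pr => e e0.
rewrite add0r.
have MN0 : 0 < `|M| + `|N| + 1 by rewrite ltr_wpDl// addr_ge0.
have [s xs] := ptensor_dense x (divr_gt0 e0 MN0).
set y := \sum_(q <- s) _ in xs.
have fgy : f y = g y.
  by rewrite /y !linear_sum; apply: eq_bigr => q _; exact: fg.
apply: (@le_trans _ _ (rnorm (f (x - y)) + rnorm (g (x - y)))).
  apply: (le_trans (rnorm_tri (f y) _ _)); rewrite {2}fgy.
  by rewrite [X in _ + X]rnorm_distC -!linearB.
apply: (@le_trans _ _ ((`|M| + `|N| + 1) * rnorm (x - y))).
  rewrite !mulrDl mul1r -[leLHS]addr0 lerD ?rnorm_ge0// lerD//.
    by rewrite (le_trans (fM _))// ler_wpM2r ?rnorm_ge0// ler_norm.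
  by rewrite (le_trans (gN _))// ler_wpM2r ?rnorm_ge0// ler_norm.
by rewrite mulrC -ler_pdivlMr// ltW.
Qed.

Section plift.
Variable Z : completeNormedModType R[i].

(* For bounded bilinear B, the bounded linear map with a (x) b |-> B a b. *)
Definition plift (B : E -> F -> Z) : ptensor -> Z := cext (alift B).

Variables (B : {bilinear E -> F -> Z}) (M : R).
Hypothesis BM : forall a b, rnorm (B a b) <= M * (rnorm a * rnorm b).

HB.instance Definition _ :=
  GRing.isLinear.Build R[i] (atensor E F) Z _ (alift B) (alift_linear B).

Let aL : {linear atensor E F -> Z} := alift B.

Lemma alift_bound x : rnorm (alift B x) <= `|M| * projective_norm x.
Proof.
have [M0|M0] := eqVneq `|M| 0.
  rewrite M0 mul0r /alift -lecR rnormE; move: M0 => /eqP; rewrite normr_eq0.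
  move=> /eqP M0; rewrite big1 ?normr0// => q _.
  apply/eqP; rewrite -normr_eq0 -rnormE; apply/eqP; congr (_%:C); apply/eqP.
  by rewrite eq_le rnorm_ge0 andbT (le_trans (BM _ _))// M0 mul0r.
have Mgt0 : 0 < `|M| by rewrite lt_neqAle eq_sym M0 normr_ge0.
rewrite -ler_pdivrMl//; apply: projective_norm_ge => s ->.
rewrite alift_sum ler_pdivrMl// /tmass mulr_sumr -lecR rnormE rmorph_sum /=.
apply: (le_trans (ler_norm_sum _ _ _)); apply: ler_sum => q _.
rewrite -rnormE lecR (le_trans (BM _ _))// ler_wpM2r ?ler_norm//.
by rewrite mulr_ge0 ?rnorm_ge0.
Qed.

Lemma plift_linear : linear (plift B).
Proof. exact: (@cext_linear _ _ projective_seminorm _ aL _ alift_bound). Qed.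

Lemma plift_bound x : rnorm (plift B x) <= `|M| * rnorm x.
Proof. exact: (@cext_bound _ _ projective_seminorm _ aL _ alift_bound). Qed.

Lemma plift_tens a b : plift B (tens a b) = B a b.
Proof.
rewrite -(alift_atens B a b).
exact: (@cext_to_completion _ _ projective_seminorm _ aL _ alift_bound).
Qed.

End plift.

End ProjectiveTensorProduct.

(* The completed projective tensor product. Its universal property is given by
   [plift_tens], [plift_linear], [plift_bound] and [ptensor_ext]. *)
Notation ptensor E F := (completion (projective_seminorm E F)).

(* The operator norm, meaningful for bounded linear f. *)
Definition opnorm (R : realType) (V W : normedModType R[i]) (f : V -> W) : R :=
  sup [set rnorm (f x) | x in [set x | rnorm x <= 1]].

Lemma bilinear_bounded_continuous (R : realType) (U V W : normedModType R[i])
    (f : {bilinear U -> V -> W}) (M : R) :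
  (forall u v, rnorm (f u v) <= M * (rnorm u * rnorm v)) ->
  continuous (fun q : U * V => f q.1 q.2).
Proof.
move=> fM [u v]; apply/cvgrPdist_lt => eps eps0.
have [e e0 ->] := gt0_complexE eps0.
pose C := `|M| + 1; have C0 : 0 < C by rewrite ltr_wpDl.
have {}fM x y : rnorm (f x y) <= C * (rnorm x * rnorm y).
  rewrite (le_trans (fM _ _))// ler_wpM2r ?mulr_ge0 ?rnorm_ge0//.
  by rewrite (le_trans (ler_norm _))// lerDl.
pose D := rnorm u + rnorm v + 1.
have D0 : 0 < D by rewrite ltr_wpDl// addr_ge0 ?rnorm_ge0.
pose d := Num.min 1 (e / (C * D)).
have d0 : 0 < d by rewrite lt_min ltr01 divr_gt0// mulr_gt0.
have d0C : (0 : R[i]) < d%:C by rewrite ltcR.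
have nu : \forall q \near (nbhs (u, v)), `|u - q.1| < d%:C.
  have fu : fst @ nbhs (u, v) --> u by exact: cvg_fst.
  exact: cvgr_dist_lt fu _ d0C.
have nv : \forall q \near (nbhs (u, v)), `|v - q.2| < d%:C.
  have sv : snd @ nbhs (u, v) --> v by exact: cvg_snd.
  exact: cvgr_dist_lt sv _ d0C.
apply: filterS2 nu nv => -[x y] /=; rewrite -!rnormE !ltcR => ux vy.
have -> : f u v - f x y = f u (v - y) + f (u - x) y.
  by rewrite linearBr linearBl addrA subrK.
have tri (w w' : W) : rnorm (w + w') <= rnorm w + rnorm w'.
  by rewrite -lecR rmorphD /= !rnormE ler_normD.
apply: (le_lt_trans (tri _ _)).
have yv : rnorm y <= rnorm v + 1.
  rewrite -lerBlDl; apply: le_trans (ltW (lt_le_trans vy _)); last first.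
    by rewrite ge_min lexx.
  rewrite rnorm_distC lerBlDr; have := rnorm_tri v y 0.
  by rewrite !subr0.
apply: (@le_lt_trans _ _ (C * (rnorm u * rnorm (v - y)) +
    C * (rnorm (u - x) * (rnorm v + 1)))).
  apply: lerD => //; apply: (le_trans (fM _ _)).
  by rewrite !ler_wpM2l ?rnorm_ge0// ltW.
have [ru rv] := (rnorm_ge0 u, rnorm_ge0 v).
have de : d * (C * D) <= e by rewrite -ler_pdivlMr ?mulr_gt0// ge_min lexx orbT.
apply: lt_le_trans de.
rewrite -mulrDr mulrCA ltr_pM2l//.
have -> : d * D = rnorm u * d + d * (rnorm v + 1).
  by rewrite /D -addrA mulrDr [d * rnorm u]mulrC.
apply: ler_ltD; last by rewrite ltr_pM2r// ltr_wpDl.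
by rewrite ler_wpM2l// ltW.
Qed.

Record banachAlgebra (R : realType) := BanachAlgebra {
  ba_space :> completeNormedModType R[i];
  ba_mul : {bilinear ba_space -> ba_space -> ba_space};
  ba_mulA : associative ba_mul;
  ba_normM : forall a b, `|ba_mul a b| <= `|a| * `|b| }.

Notation "a '∗' b" := (ba_mul _ a b) (at level 40, left associativity).

Record banachBimodule (R : realType) (A : banachAlgebra R) := BanachBimodule {
  bm_space :> completeNormedModType R[i];
  lact : {bilinear A -> bm_space -> bm_space};
  ract : {bilinear bm_space -> A -> bm_space};
  lact_continuous : continuous (fun q : A * bm_space => lact q.1 q.2);
  ract_continuous : continuous (fun q : bm_space * A => ract q.1 q.2);
  lactA : forall a b x, lact (a ∗ b) x = lact a (lact b x);
  ractA : forall x a b, ract x (a ∗ b) = ract (ract x a) b;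
  lractA : forall a x b, ract (lact a x) b = lact a (ract x b) }.

Section Bimodules.
Variables (R : realType) (A : banachAlgebra R).

Definition bimodule_morphism (X Y : banachBimodule A) (f : {linear X -> Y}) :=
  [/\ continuous f,
      forall a x, f (lact X a x) = lact Y a (f x) &
      forall x a, f (ract X x a) = ract Y (f x) a].

Definition admissible_epimorphism (X Y : banachBimodule A)
    (sigma : {linear X -> Y}) :=
  [/\ bimodule_morphism sigma,
      forall y, exists x, sigma x = y &
      exists2 s : {linear Y -> X}, continuous s & forall y, sigma (s y) = y].

Definition projective_bimodule (P : banachBimodule A) :=
  forall (X Y : banachBimodule A) (sigma : {linear X -> Y})
         (phi : {linear P -> Y}),
    admissible_epimorphism sigma -> bimodule_morphism phi ->
    exists2 psi : {linear P -> X},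
      bimodule_morphism psi & forall x, sigma (psi x) = phi x.

Lemma ba_mul_continuous : continuous (fun q : A * A => q.1 ∗ q.2).
Proof.
apply: (@bilinear_bounded_continuous _ _ _ _ (ba_mul A) 1) => a b.
by rewrite mul1r -lecR rmorphM /= !rnormE ba_normM.
Qed.

Definition regular_bimodule : banachBimodule A :=
  @BanachBimodule R A A (ba_mul A) (ba_mul A)
    ba_mul_continuous ba_mul_continuous
    (fun a b x => esym (ba_mulA a b x)) (fun x a b => ba_mulA x a b)
    (fun a x b => esym (ba_mulA a x b)).

Definition biprojective := projective_bimodule regular_bimodule.

Local Notation T := (ptensor A A).

Definition product_map : T -> A := plift (ba_mul A).

Definition tensor_lact (a : A) : T -> T := plift (fun b c => tens (a ∗ b) c).
Definition tensor_ract (t : T) (a : A) : T :=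
  plift (fun b c => tens b (c ∗ a)) t.

Lemma rnorm_mul (a b : A) : rnorm (a ∗ b) <= rnorm a * rnorm b.
Proof. by rewrite -lecR rmorphM /= !rnormE ba_normM. Qed.

Let lt (a b c : A) : T := tens (a ∗ b) c.
Let rt (a b c : A) : T := tens b (c ∗ a).

Let lt_bilinear a : bilinear_for *:%R *:%R (lt a).
Proof.
by split=> [c|b] k x y; rewrite /lt ?linearPr ?linearPl.
Qed.

Let rt_bilinear a : bilinear_for *:%R *:%R (rt a).
Proof.
by split=> [c|b] k x y; rewrite /rt ?linearPl ?linearPr.
Qed.

HB.instance Definition _ a :=
  bilinear_isBilinear.Build R[i] A A T _ _ (lt a) (lt_bilinear a).
HB.instance Definition _ a :=
  bilinear_isBilinear.Build R[i] A A T _ _ (rt a) (rt_bilinear a).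

Let lt_bound a b c : rnorm (lt a b c) <= rnorm a * (rnorm b * rnorm c).
Proof.
rewrite (le_trans (rnorm_tens _ _))// mulrA.
by rewrite ler_wpM2r ?rnorm_ge0// rnorm_mul.
Qed.

Let rt_bound a b c : rnorm (rt a b c) <= rnorm a * (rnorm b * rnorm c).
Proof.
rewrite (le_trans (rnorm_tens _ _))// mulrCA ler_wpM2l ?rnorm_ge0//.
by rewrite mulrC rnorm_mul.
Qed.

Lemma tensor_lact_tens a b c : tensor_lact a (tens b c) = tens (a ∗ b) c.
Proof. exact: (@plift_tens _ _ _ T (lt a) _ (lt_bound a)). Qed.

Lemma tensor_ract_tens a b c : tensor_ract (tens b c) a = tens b (c ∗ a).
Proof. exact: (@plift_tens _ _ _ T (rt a) _ (rt_bound a)). Qed.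

Lemma tensor_lact_linear a : linear (tensor_lact a).
Proof. exact: (@plift_linear _ _ _ T (lt a) _ (lt_bound a)). Qed.

Lemma tensor_ract_linear a : linear (tensor_ract^~ a).
Proof. exact: (@plift_linear _ _ _ T (rt a) _ (rt_bound a)). Qed.

Lemma rnorm_tensor_lact a t : rnorm (tensor_lact a t) <= rnorm a * rnorm t.
Proof.
by have := @plift_bound _ _ _ T (lt a) _ (lt_bound a) t; rewrite ger0_norm// rnorm_ge0.
Qed.

Lemma rnorm_tensor_ract t a : rnorm (tensor_ract t a) <= rnorm t * rnorm a.
Proof.
have := @plift_bound _ _ _ T (rt a) _ (rt_bound a) t.
by rewrite ger0_norm ?rnorm_ge0// [X in _ <= X]mulrC.
Qed.

Let lbound a : exists M : R, forall t, rnorm (tensor_lact a t) <= M * rnorm t.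
Proof. by exists (rnorm a); exact: rnorm_tensor_lact. Qed.

Let rbound a : exists M : R, forall t, rnorm (tensor_ract t a) <= M * rnorm t.
Proof.
by exists (rnorm a) => t; rewrite mulrC; exact: rnorm_tensor_ract.
Qed.

Let bound_comp (f g : T -> T) :
  (exists M : R, forall t, rnorm (f t) <= M * rnorm t) ->
  (exists M : R, forall t, rnorm (g t) <= M * rnorm t) ->
  exists M : R, forall t, rnorm (f (g t)) <= M * rnorm t.
Proof.
move=> [M fM] [N gN]; exists (`|M| * N) => t.
rewrite (le_trans (fM _))// (@le_trans _ _ (`|M| * rnorm (g t)))//.
  by rewrite ler_wpM2r ?rnorm_ge0// ler_norm.
by rewrite -mulrA ler_wpM2l.
Qed.

Let bound_lin (k : R[i]) (f g : T -> T) :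
  (exists M : R, forall t, rnorm (f t) <= M * rnorm t) ->
  (exists M : R, forall t, rnorm (g t) <= M * rnorm t) ->
  exists M : R, forall t, rnorm (k *: f t + g t) <= M * rnorm t.
Proof.
move=> [M fM] [N gN]; exists (rnorm k * M + N) => t.
have tri (w w' : T) : rnorm (w + w') <= rnorm w + rnorm w'.
  by rewrite -lecR rmorphD /= !rnormE ler_normD.
rewrite (le_trans (tri _ _))// mulrDl lerD//.
have -> : rnorm (k *: f t) = rnorm k * rnorm (f t).
  by apply: complexI; rewrite rmorphM /= !rnormE normrZ.
by rewrite -mulrA ler_wpM2l ?rnorm_ge0.
Qed.

Let lin_comp (f g : T -> T) : linear f -> linear g -> linear (f \o g).
Proof. by move=> lf lg k x y /=; rewrite lg lf. Qed.

Let lin_lin (k : R[i]) (f g : T -> T) :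
  linear f -> linear g -> linear (fun t => k *: f t + g t).
Proof.
move=> lf lg l x y /=; rewrite lf lg !scalerDr !scalerA [k * l]mulrC.
by rewrite addrACA.
Qed.

Lemma tensor_lact_bilinear : bilinear_for *:%R *:%R tensor_lact.
Proof.
split=> [t k a a'|a]; last exact: tensor_lact_linear.
rewrite /=; move: t; apply: ptensor_ext.
- exact: tensor_lact_linear.
- by apply: lin_lin; exact: tensor_lact_linear.
- exact: lbound.
- exact: bound_lin.
- by move=> b c; rewrite !tensor_lact_tens !linearPl.
Qed.

Lemma tensor_ract_bilinear : bilinear_for *:%R *:%R tensor_ract.
Proof.
split=> [a|t k a a']; first exact: tensor_ract_linear.
rewrite /=; move: t; apply: ptensor_ext.
- exact: tensor_ract_linear.
- by apply: lin_lin; exact: tensor_ract_linear.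
- exact: rbound.
- by apply: bound_lin; exact: rbound.
- by move=> b c; rewrite !tensor_ract_tens !linearPr.
Qed.

HB.instance Definition _ :=
  bilinear_isBilinear.Build R[i] A T T _ _ tensor_lact tensor_lact_bilinear.
HB.instance Definition _ :=
  bilinear_isBilinear.Build R[i] T A T _ _ tensor_ract tensor_ract_bilinear.

Lemma tensor_lact_continuous :
  continuous (fun q : A * T => tensor_lact q.1 q.2).
Proof.
apply: (@bilinear_bounded_continuous _ _ _ _ tensor_lact 1) => a t.
by rewrite mul1r rnorm_tensor_lact.
Qed.

Lemma tensor_ract_continuous :
  continuous (fun q : T * A => tensor_ract q.1 q.2).
Proof.
apply: (@bilinear_bounded_continuous _ _ _ _ tensor_ract 1) => t a.
by rewrite mul1r rnorm_tensor_ract.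
Qed.

Lemma tensor_lactA a b t :
  tensor_lact (a ∗ b) t = tensor_lact a (tensor_lact b t).
Proof.
move: t; apply: ptensor_ext.
- exact: tensor_lact_linear.
- by apply: lin_comp; exact: tensor_lact_linear.
- exact: lbound.
- exact: bound_comp.
- by move=> c d; rewrite !tensor_lact_tens ba_mulA.
Qed.

Lemma tensor_ractA t a b :
  tensor_ract t (a ∗ b) = tensor_ract (tensor_ract t a) b.
Proof.
move: t; apply: ptensor_ext.
- exact: tensor_ract_linear.
- by apply: (@lin_comp (tensor_ract^~ b) (tensor_ract^~ a));
    exact: tensor_ract_linear.
- exact: rbound.
- by apply: (@bound_comp (tensor_ract^~ b) (tensor_ract^~ a)); exact: rbound.
- by move=> c d; rewrite !tensor_ract_tens ba_mulA.
Qed.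

Lemma tensor_lractA a t b :
  tensor_ract (tensor_lact a t) b = tensor_lact a (tensor_ract t b).
Proof.
move: t; apply: ptensor_ext.
- apply: (@lin_comp (tensor_ract^~ b) (tensor_lact a)).
    exact: tensor_ract_linear.
  exact: tensor_lact_linear.
- apply: (@lin_comp (tensor_lact a) (tensor_ract^~ b)).
    exact: tensor_lact_linear.
  exact: tensor_ract_linear.
- apply: (@bound_comp (tensor_ract^~ b) (tensor_lact a)).
    exact: rbound.
  exact: lbound.
- apply: (@bound_comp (tensor_lact a) (tensor_ract^~ b)).
    exact: lbound.
  exact: rbound.
- by move=> c d; rewrite !(tensor_lact_tens, tensor_ract_tens).
Qed.

Definition tensor_bimodule : banachBimodule A :=
  @BanachBimodule R A T tensor_lact tensor_ract
    tensor_lact_continuous tensor_ract_continuous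
    tensor_lactA tensor_ractA tensor_lractA.

Lemma product_map_tens a b : product_map (tens a b) = a ∗ b.
Proof.
apply: (@plift_tens _ _ _ _ (ba_mul A) 1) => {}a {}b.
by rewrite mul1r rnorm_mul.
Qed.

End Bimodules.

Record directedSet := DirectedSet {
  ds_index :> Type;
  ds_le : ds_index -> ds_index -> Prop;
  ds_refl : forall i, ds_le i i;
  ds_trans : forall i j k, ds_le i j -> ds_le j k -> ds_le i k;
  ds_directed : forall i j, exists k, ds_le i k /\ ds_le j k;
  ds_inhabited : inhabited ds_index }.

Definition tails (D : directedSet) : set_system D :=
  [set P | exists i, forall j, ds_le i j -> P j].

Arguments tails : clear implicits.

#[global] Instance tails_proper (D : directedSet) : ProperFilter (tails D).
Proof.
apply: Build_ProperFilter.
- by move=> [i /(_ i (ds_refl i))].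
- split=> [|P Q [i Pi] [j Qj]|P Q PQ [i Pi]].
  + by case: (ds_inhabited D) => i; exists i.
  + have [k [ik jk]] := ds_directed i j; exists k => l kl.
    by split; [apply: Pi|apply: Qj]; exact: ds_trans kl.
  + by exists i => j ij; exact/PQ/Pi.
Qed.

Definition uniform_approx_morphism (R : realType) (A : banachAlgebra R)
    (X Y : banachBimodule A) (D : directedSet) (phi : D -> {linear X -> Y}) :=
  (forall nu, continuous (phi nu)) /\
  forall (S : set A) (B : set X), bounded_set S -> bounded_set B ->
  forall eps : R, 0 < eps -> \forall nu \near tails D,
    forall a x, S a -> B x ->
      rnorm (phi nu (lact X a x) - lact Y a (phi nu x)) < eps /\
      rnorm (phi nu (ract X x a) - ract Y (phi nu x) a) < eps.

(* Main.v *)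
From HB Require Import structures.
Require Import Defs.
From mathcomp Require Import all_boot all_order all_algebra.
From mathcomp Require Import complex ring lra.
From mathcomp Require Import all_classical all_reals all_analysis.
Import Order.TTheory GRing.Theory Num.Theory numFieldNormedType.Exports.
Local Open Scope classical_set_scope.
Local Open Scope ring_scope.

Set Implicit Arguments.
Unset Strict Implicit.
Unset Printing Implicit Defensive.

(** A single exact bimodule section mediates between the two conditions: both
are equivalent to the existence of a bounded bimodule morphism N from A to the
projective tensor square of A with product_map (N a) = a.

From a biprojective A such a section is obtained by lifting the identity of A
through the augmentation ideal of the free bimodule on one generator over the
unitization of A. Written without adjoining a unit, this ideal is the space of
triples (u, v, w), with u and v in A and w in the tensor square; it maps onto A
by u + v + product_map w, and the lift has three components. The components u
and v vanish on products ([biprojective_exact_section]), and biprojectivity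
forces every bounded operator vanishing on products to be zero
([map_kills_products]): by the Hahn-Banach theorem it is enough to see this for
functionals h, and a non-zero h that vanishes on products defines a non-split
extension of trivial bimodules through which the rank-one morphism h(a) e
cannot be lifted ([functional_kills_products]). So only w remains, and w is the
section.

From an exact section N and an admissible epimorphism onto Y with linear right
inverse s, a morphism phi from A to Y is lifted by averaging s o phi on both
sides: split a as a sum of x y z by applying N twice, and send a to the sum of
x . s (phi y) . z ([exact_section_biprojective]).

The substance of the converse is that approximate sections can be made exact,
although their norms are not controlled by their errors. For an operator N from
A to the tensor square put d(x, y) = N (x y) - x . N y, and let L be the linear
map on the tensor square with L (x (x) y) = d(x, y). If rho is any operator,
then the defect of N - L o rho at (c, a) is
  d(c, a - product_map (rho a)) - L (rho (c a) - c . rho a),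
which is at most |d| times the total error of rho; the norm of rho does not
enter. Hence iterating N |-> N - L o rho converges geometrically. If moreover
product_map o N = 1 at the start, this persists. A left module section sigma
with product_map o sigma = 1 results ([averaging]). One now takes an
approximate section rho whose errors are small compared with 1 / |sigma|, and
corrects it once by sigma: the outcome is an exact left module morphism
uniformly close to rho, hence still nearly a right module morphism
([left_correction]). Averaging with respect to it over the opposite algebra
makes it exact on the right; the left module property survives because the
averaging operator has it too ([exact_section]). *)

(** * Bounded linear and bilinear maps *)

Section BoundedLinear.
Variable R : realType.
Implicit Types U V W : normedModType R[i].

Lemma rnormD V (x y : V) : rnorm (x + y) <= rnorm x + rnorm y.
Proof. by rewrite -lecR rmorphD /= !rnormE ler_normD. Qed.

Lemma rnormB V (x y : V) : rnorm (x - y) <= rnorm x + rnorm y.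
Proof. by rewrite -[rnorm y](congr1 _ (normrN y)) rnormD. Qed.

Lemma rnormZ V (k : R[i]) (x : V) : rnorm (k *: x) = rnorm k * rnorm x.
Proof. by apply: complexI; rewrite rmorphM /= !rnormE normrZ. Qed.

Lemma rnorm0 V : rnorm (0 : V) = 0.
Proof. by rewrite /rnorm normr0. Qed.

Lemma rnorm_real (r : R) : rnorm r%:C%C = `|r|.
Proof. by rewrite /rnorm normc_def /= expr0n addr0 sqrtr_sqr. Qed.

Lemma rnorm_eq0 V (x : V) : rnorm x = 0 -> x = 0.
Proof. by move=> x0; apply/eqP; rewrite -normr_eq0 -rnormE x0. Qed.

(** Identities for limits of operators are proved through this criterion: the two
sides differ by less than any error level, up to a fixed factor K. *)
Lemma rnorm_small V (x : V) (K : R) :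
  (forall e, 0 < e -> rnorm x <= e * K) -> x = 0.
Proof.
move=> xK; apply: rnorm_eq0; apply/eqP; rewrite eq_le rnorm_ge0 andbT.
have K1 : 0 < `|K| + 1 by rewrite ltr_wpDl.
apply/ler_addgt0Pr => e e0; rewrite add0r.
apply: (le_trans (xK (e / (`|K| + 1)) (divr_gt0 e0 K1))).
rewrite mulrAC ler_pdivrMr// ler_pM2l//.
by rewrite (le_trans (ler_norm K))// lerDl.
Qed.

(** The constant is real and nonnegative, so that bounds can be multiplied. *)
Definition bounded_map V W (f : V -> W) :=
  exists2 M : R, 0 <= M & forall x, rnorm (f x) <= M * rnorm x.

Lemma bounded_mapP V W (f : {linear V -> W}) : bounded_map f <-> continuous f.
Proof.
rewrite -bounded_linearP; split=> [[M _ fM]|[M fM]]; first by exists M.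
exists `|M| => // x; rewrite (le_trans (fM x))// ler_wpM2r ?rnorm_ge0//.
exact: ler_norm.
Qed.

Lemma bounded_map_weak V W (f : V -> W) : bounded_map f ->
  exists M : R, forall x, rnorm (f x) <= M * rnorm x.
Proof. by move=> [M _ fM]; exists M. Qed.

Lemma bounded_comp U V W (f : V -> W) (g : U -> V) :
  bounded_map f -> bounded_map g -> bounded_map (f \o g).
Proof.
move=> [M M0 fM] [N N0 gN]; exists (M * N) => [|x /=]; first exact: mulr_ge0.
by rewrite (le_trans (fM _))// -mulrA ler_wpM2l.
Qed.

Lemma bounded_id V : bounded_map (@id V).
Proof. by exists 1 => // x; rewrite mul1r. Qed.

Lemma bounded_zero V W : bounded_map (fun _ : V => 0 : W).
Proof. by exists 0 => // x; rewrite rnorm0 mul0r. Qed.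

Lemma bounded_add V W (f g : V -> W) :
  bounded_map f -> bounded_map g -> bounded_map (fun x => f x + g x).
Proof.
move=> [M M0 fM] [N N0 gN]; exists (M + N) => [|x /=]; first exact: addr_ge0.
by rewrite (le_trans (rnormD _ _))// mulrDl lerD.
Qed.

Lemma bounded_sub V W (f g : V -> W) :
  bounded_map f -> bounded_map g -> bounded_map (fun x => f x - g x).
Proof.
move=> [M M0 fM] [N N0 gN]; exists (M + N) => [|x /=]; first exact: addr_ge0.
by rewrite (le_trans (rnormB _ _))// mulrDl lerD.
Qed.

(** Gives an operator defined by a formula its linear structure, while keeping the
formula from unfolding. *)
Lemma pack_linear V W (f : V -> W) : linear f -> {g : {linear V -> W} | g =1 f}.
Proof.
move=> lf; pose g : {linear V -> W} := HB.pack f (GRing.isLinear.Build _ _ _ _ f lf).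
by exists g.
Qed.

Lemma pack_bilinear U V W (f : U -> V -> W) : bilinear_for *:%R *:%R f ->
  {g : {bilinear U -> V -> W} | forall x y, g x y = f x y}.
Proof.
move=> lf.
pose g : {bilinear U -> V -> W} :=
  HB.pack f (bilinear_isBilinear.Build R[i] U V W _ _ f lf).
by exists g.
Qed.

Lemma scale_to_norm V (x : V) (r : R) : x != 0 -> 0 < r ->
  exists2 k : R[i], rnorm k = r / rnorm x & rnorm (k *: x) = r.
Proof.
move=> x0 r0; have nx : 0 < rnorm x by rewrite -ltcR rnormE normr_gt0.
exists (r / rnorm x)%:C%C; first by rewrite rnorm_real gtr0_norm// divr_gt0.
by rewrite rnormZ rnorm_real gtr0_norm ?divr_gt0// divfK// gt_eqF.
Qed.

(** Uniform smallness on balls is the form in which approximate morphisms are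
given; estimates by the product of the norms follow by rescaling. *)
Lemma bilinear_bound_of_unit U V W (f : {bilinear U -> V -> W}) (r c : R) :
  0 < r -> (forall x y, rnorm x <= r -> rnorm y <= r -> rnorm (f x y) <= c) ->
  forall x y, rnorm (f x y) <= c / r ^+ 2 * (rnorm x * rnorm y).
Proof.
move=> r0 fc x y.
have [->|x0] := eqVneq x 0; first by rewrite linear0l !rnorm0 mul0r mulr0.
have [->|y0] := eqVneq y 0; first by rewrite linear0r !rnorm0 !mulr0.
have [k kE kx] := scale_to_norm x0 r0; have [l lE ly] := scale_to_norm y0 r0.
have nx : 0 < rnorm x by rewrite -ltcR rnormE normr_gt0.
have ny : 0 < rnorm y by rewrite -ltcR rnormE normr_gt0.
have := fc (k *: x) (l *: y); rewrite kx ly => /(_ (lexx _) (lexx _)).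
rewrite linearZl_LR linearZr /= !rnormZ kE lE mulrA => H.
rewrite mulrAC ler_pdivlMr ?exprn_gt0//.
apply: le_trans (_ : rnorm (f x y) * r ^+ 2 <= _); first by [].
suff -> : rnorm (f x y) * r ^+ 2 =
  (r / rnorm x * (r / rnorm y) * rnorm (f x y)) * (rnorm x * rnorm y).
  by rewrite ler_wpM2r// mulr_ge0 ?rnorm_ge0.
by field; rewrite !gt_eqF.
Qed.

Lemma bilinear_bounded U V W (f : {bilinear U -> V -> W}) :
  continuous (fun q : U * V => f q.1 q.2) ->
  exists2 M : R, 0 <= M & forall x y, rnorm (f x y) <= M * (rnorm x * rnorm y).
Proof.
move=> /(_ (0, 0)) /cvgrPdist_lt /(_ 1 ltr01) /=.
rewrite linear0l => /nbhs_ballP[eps /= eps0 H].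
have [e e0 epsE] := gt0_complexE eps0.
have e20 : 0 < e / 2 by rewrite divr_gt0.
exists (1 / (e / 2) ^+ 2); first by rewrite divr_ge0// exprn_ge0// ltW.
apply: bilinear_bound_of_unit => // x y xe ye.
have e2e : e / 2 < e by rewrite ltr_pdivrMr// ltr_pMr// ltr1n.
have := H (x, y); rewrite /= sub0r normrN -rnormE -[1]/(1%:C%C) ltcR => {}H.
apply/ltW/H; split; rewrite -ball_normE /= sub0r normrN -rnormE epsE ltcR.
  exact: le_lt_trans xe e2e.
exact: le_lt_trans ye e2e.
Qed.

Lemma opnorm_le V W (f : {linear V -> W}) : bounded_map f ->
  forall x, rnorm (f x) <= opnorm f * rnorm x.
Proof.
move=> [M M0 fM] x.
have [->|x0] := eqVneq x 0; first by rewrite linear0 !rnorm0 mulr0.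
have nx : 0 < rnorm x by rewrite -ltcR rnormE normr_gt0.
have [k kE kx] := scale_to_norm x0 ltr01.
have : rnorm (f (k *: x)) <= opnorm f.
  apply: ub_le_sup; last by exists (k *: x) => //=; rewrite kx.
  exists M => _ [y /= y1 <-]; apply: (le_trans (fM y)).
  by rewrite ler_piMr.
by rewrite linearZ /= rnormZ kE mul1r mulrC ler_pdivrMr.
Qed.
End BoundedLinear.

(** * Geometric iteration of operators *)

Section GeometricIteration.
Variables (R : realType) (V : normedModType R[i]) (W : completeNormedModType R[i]).

Lemma rnorm_cvgP (u : nat -> W) (l : W) :
  u @ \oo --> l <->
  forall e : R, 0 < e -> exists n, forall k, (n <= k)%N -> rnorm (l - u k) < e.
Proof.
split=> [/cvgrPdist_lt ul e e0|ul].
  have [|n _ un] := ul e%:C%C; first by rewrite ltcR.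
  by exists n => k nk; have := un k nk; rewrite /= -rnormE ltcR.
apply/cvgrPdist_lt => eps eps0; have [e e0 ->] := gt0_complexE eps0.
have [n un] := ul e e0; exists n => // k /= nk.
by rewrite -rnormE ltcR un.
Qed.

Lemma rnorm_cauchy_cvg (u : nat -> W) :
  (forall e : R, 0 < e -> exists n, forall k, (n <= k)%N -> rnorm (u n - u k) < e) ->
  cvgn u.
Proof.
move=> cu; apply/cauchy_cvgP/cauchyP => eps eps0.
have [e e0 ->] := gt0_complexE eps0; have [n un] := cu e e0.
by exists (u n), n => // k /= nk; rewrite -ball_normE /= -rnormE ltcR un.
Qed.

Lemma geometric_small (q D e : R) : 0 <= q < 1 -> 0 < e ->
  exists n : nat, D * q ^+ n < e.
Proof.
move=> /andP[q0 q1] e0.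
have : (fun n : nat => D * q ^+ n) @ \oo --> D * 0.
  by apply: cvgMr; apply: cvg_expr; rewrite ger0_norm.
rewrite mulr0 => /cvgrPdist_lt /(_ e e0)[n _ H]; exists n.
have := H n (leqnn n); rewrite /= sub0r normrN; apply: le_lt_trans.
exact: ler_norm.
Qed.

Lemma geometric_limit (u : nat -> {linear V -> W}) (q D : R) :
  0 <= q < 1 -> 0 <= D ->
  (forall k x, rnorm (u k.+1 x - u k x) <= D * q ^+ k * rnorm x) ->
  exists g : {linear V -> W},
    forall k x, rnorm (g x - u k x) <= D / (1 - q) * q ^+ k * rnorm x.
Proof.
move=> /[dup] q01 /andP[q0 q1] D0 uD; set E := D / (1 - q).
have q1' : 0 < 1 - q by rewrite subr_gt0.
have E0 : 0 <= E by rewrite divr_ge0// ltW.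
have tail k n x :
    rnorm (u (k + n)%N x - u k x) <= E * (q ^+ k - q ^+ (k + n)) * rnorm x.
  elim: n => [|n IH]; first by rewrite addn0 !subrr rnorm0 mulr0 mul0r.
  apply: (le_trans (rnorm_tri (u (k + n)%N x) _ _)); rewrite addnS.
  have -> : E * (q ^+ k - q ^+ (k + n).+1) * rnorm x =
    D * q ^+ (k + n) * rnorm x + E * (q ^+ k - q ^+ (k + n)) * rnorm x.
    by rewrite /E exprS; field; rewrite gt_eqF.
  by rewrite lerD.
have {}tail k n x : (k <= n)%N -> rnorm (u n x - u k x) <= E * q ^+ k * rnorm x.
  move=> /subnKC <-; apply: (le_trans (tail _ _ _)).
  rewrite ler_wpM2r ?rnorm_ge0// ler_wpM2l// gerBl exprn_ge0//.
have cu x : cvgn (fun k => u k x).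
  apply: rnorm_cauchy_cvg => e e0.
  have [n nE] := @geometric_small q (E * rnorm x) e q01 e0.
  exists n => k nk; rewrite rnorm_distC; apply: le_lt_trans nE.
  by rewrite mulrAC tail.
pose f x := lim ((fun k => u k x) @ \oo).
have lf : linear f.
  move=> c x y; apply/cvg_lim => //.
  rewrite (_ : (fun k => _) = (fun k => c *: u k x + u k y)); last first.
    by apply/funext => k /=; rewrite linearP.
  by apply: cvgD; [apply: cvgZr|]; exact: cu.
have [g gf] := pack_linear lf; exists g => k x.
apply/ler_addgt0Pr => e e0.
have /rnorm_cvgP/(_ e e0)[n un] : (fun k => u k x) @ \oo --> f x by exact: cu.
rewrite gf; apply: (le_trans (rnorm_tri (u (maxn k n) x) _ _)).
by rewrite addrC lerD ?tail ?leq_maxl// ltW// un// leq_maxr.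
Qed.

(** A step improves the error level l of an operator by the factor q and moves the
operator by at most C l, so the iterates converge in norm. The limit is
described only through nearby operators of arbitrarily small error, which is
what is needed to transfer closed conditions to it. *)
Lemma geometric_iteration (P : {linear V -> W} -> R -> Prop) (q C : R) :
  0 <= q < 1 -> 0 <= C ->
  (forall N l, 0 <= l -> P N l -> exists2 N' : {linear V -> W}, P N' (q * l) &
     forall x, rnorm (N' x - N x) <= C * l * rnorm x) ->
  forall N0 l0, 0 <= l0 -> P N0 l0 ->
  exists N : {linear V -> W}, forall e, 0 < e ->
    exists N' l, [/\ 0 <= l <= e, P N' l &
      forall x, rnorm (N x - N' x) <= e * rnorm x].
Proof.
move=> q01 C0 step N0 l0 l00 PN0; have [q0 _] := andP q01.
pose S := {p : {linear V -> W} * R | 0 <= p.2 /\ P p.1 p.2}.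
have /choice[g gP] : forall s : S, exists s' : S,
    (sval s').2 = q * (sval s).2 /\
    forall x, rnorm ((sval s').1 x - (sval s).1 x) <= C * (sval s).2 * rnorm x.
  move=> [[N l] /= [l0' PN]]; have [N' PN' NN'] := step _ _ l0' PN.
  by exists (exist _ (N', q * l) (conj (mulr_ge0 q0 l0') PN')).
pose u k : S := iter k g (exist _ (N0, l0) (conj l00 PN0)).
have ul k : (sval (u k)).2 = q ^+ k * l0.
  elim: k => [|k IH]; first by rewrite mul1r.
  by rewrite [u k.+1]/= (proj1 (gP _)) -/(u k) IH exprS mulrA.
have uC k x : rnorm ((sval (u k.+1)).1 x - (sval (u k)).1 x) <=
    (C * l0) * q ^+ k * rnorm x.
  by apply: (le_trans (proj2 (gP (u k)) x)); rewrite ul [q ^+ k * _]mulrC mulrA.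
have [N NP] := geometric_limit q01 (mulr_ge0 C0 l00) uC.
exists N => e e0.
set D := C * l0 / (1 - q) in NP.
have D0 : 0 <= D by rewrite divr_ge0 ?mulr_ge0// subr_ge0 ltW//; case/andP: q01.
have [k ke] := @geometric_small q (D + l0) e q01 e0.
have qk : 0 <= q ^+ k by exact: exprn_ge0.
exists (sval (u k)).1, (sval (u k)).2; rewrite ul; split.
- rewrite mulr_ge0//=; apply: le_trans (ltW ke).
  by rewrite mulrC ler_wpM2r// lerDr.
- by rewrite -ul; exact: (svalP (u k)).2.
- move=> x; apply: (le_trans (NP k x)); rewrite ler_wpM2r ?rnorm_ge0//.
  by apply: le_trans (ltW ke); rewrite ler_wpM2r// lerDl.
Qed.
End GeometricIteration.

(** * Averaging over the tensor square *)

Section TensorSquare.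
Variables (R : realType).

(** The universal property of the projective tensor square of A as a bimodule,
with j for the canonical bilinear map and p for the product. Stating it for an
arbitrary model makes it symmetric: the same space serves the opposite
algebra, with the factors exchanged. *)
Record tensor_square (A : banachAlgebra R) (T : banachBimodule A)
    (j : A -> A -> T) (p : {linear T -> A}) : Prop := TensorSquare {
  ts_lift : forall (Z : completeNormedModType R[i]) (B : {bilinear A -> A -> Z})
      (M : R), 0 <= M ->
    (forall x y, rnorm (B x y) <= M * (rnorm x * rnorm y)) ->
    exists2 L : {linear T -> Z}, forall x y, L (j x y) = B x y &
      forall t, rnorm (L t) <= M * rnorm t;
  ts_ext : forall (Z : completeNormedModType R[i]) (f g : {linear T -> Z}),
    bounded_map f -> bounded_map g ->
    (forall x y, f (j x y) = g (j x y)) -> f =1 g;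
  ts_prod_bounded : bounded_map p;
  ts_prod : forall x y, p (j x y) = x ∗ y;
  ts_lact : forall a x y, lact T a (j x y) = j (a ∗ x) y;
  ts_ract : forall a x y, ract T (j x y) a = j x (y ∗ a) }.

Section Actions.
Variables (A : banachAlgebra R) (X : banachBimodule A).

Lemma lact_bound : exists2 M : R, 0 <= M &
  forall a x, rnorm (lact X a x) <= M * (rnorm a * rnorm x).
Proof. exact/bilinear_bounded/lact_continuous. Qed.

Lemma ract_bound : exists2 M : R, 0 <= M &
  forall x a, rnorm (ract X x a) <= M * (rnorm x * rnorm a).
Proof. exact/bilinear_bounded/ract_continuous. Qed.

Lemma lact_bounded a : bounded_map (lact X a).
Proof.
have [M M0 XM] := lact_bound; exists (M * rnorm a) => [|x].
  by rewrite mulr_ge0 ?rnorm_ge0.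
by rewrite -mulrA.
Qed.

Lemma ract_bounded a : bounded_map ((ract X)^~ a).
Proof.
have [M M0 XM] := ract_bound; exists (M * rnorm a) => [|x].
  by rewrite mulr_ge0 ?rnorm_ge0.
by rewrite mulrAC -mulrA.
Qed.

End Actions.

Lemma mul_bounded (A : banachAlgebra R) (a : A) : bounded_map (ba_mul A a).
Proof. by exists (rnorm a) => [|x]; [exact: rnorm_ge0|exact: rnorm_mul]. Qed.

Lemma mulr_bounded (A : banachAlgebra R) (a : A) : bounded_map ((ba_mul A)^~ a).
Proof.
exists (rnorm a) => [|x]; first exact: rnorm_ge0.
by rewrite mulrC; exact: rnorm_mul.
Qed.

Section Averaging.
Variables (A : banachAlgebra R) (T : banachBimodule A) (j : A -> A -> T).
Variable p : {linear T -> A}.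
Hypothesis tsq : tensor_square j p.

Lemma ts_ext_fun (Z : completeNormedModType R[i]) (f g : T -> Z) :
  linear f -> linear g -> bounded_map f -> bounded_map g ->
  (forall x y, f (j x y) = g (j x y)) -> f =1 g.
Proof.
move=> lf lg bf bg fg t.
have [f' f'E] := pack_linear lf; have [g' g'E] := pack_linear lg.
rewrite -f'E -g'E; apply: (ts_ext tsq).
- by have [M M0 fM] := bf; exists M => // x; rewrite f'E.
- by have [M M0 gM] := bg; exists M => // x; rewrite g'E.
- by move=> x y; rewrite f'E g'E.
Qed.

Lemma ts_prod_lact a t : p (lact T a t) = a ∗ p t.
Proof.
move: t; apply: ts_ext_fun => [k t u|k t u| | |x y].
- by rewrite !linearPr linearP.
- by rewrite linearP linearPr.
- by apply: bounded_comp; [exact: ts_prod_bounded tsq|exact: lact_bounded].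
- by apply: bounded_comp; [exact: mul_bounded|exact: ts_prod_bounded tsq].
- by rewrite (ts_lact tsq) !(ts_prod tsq) ba_mulA.
Qed.

Lemma ts_prod_ract t a : p (ract T t a) = p t ∗ a.
Proof.
move: t; apply: ts_ext_fun => [k t u|k t u| | |x y].
- by rewrite !linearPl linearP.
- by rewrite linearP linearPl.
- by apply: bounded_comp; [exact: ts_prod_bounded tsq|exact: ract_bounded].
- by apply: (bounded_comp (mulr_bounded a)); exact: ts_prod_bounded tsq.
- by rewrite (ts_ract tsq) !(ts_prod tsq) ba_mulA.
Qed.

(** A coboundary, hence a cocycle; the cocycle identity is what
[left_defect_lift] extends to the tensor square. *)
Definition left_defect (X : banachBimodule A) (N : A -> X) x y :=
  N (x ∗ y) - lact X x (N y).

Lemma left_defect_bilinear (X : banachBimodule A) (N : {linear A -> X}) :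
  bilinear_for *:%R *:%R (left_defect N).
Proof.
rewrite /left_defect; split=> [y|x] k u v /=.
  by rewrite !linearPl linearP scalerBr opprD addrACA.
by rewrite linearPr !linearP /= addrACA -scalerDr.
Qed.

Lemma left_defectBr (X : banachBimodule A) (N : {linear A -> X}) x u v :
  left_defect N x (u - v) = left_defect N x u - left_defect N x v.
Proof.
have := (left_defect_bilinear N).2 x (-1) v u.
by rewrite /= !scaleN1r ![- _ + _]addrC.
Qed.

Variable rho : {linear A -> T}.
Hypothesis rho_bounded : bounded_map rho.

(** In the second round of averaging rho is an exact one-sided morphism, and the
averaged operator has to remain one. *)
Definition inherits_right (N : A -> T) := forall c,
  (forall a, rho (a ∗ c) = ract T (rho a) c) ->
  forall a, N (a ∗ c) = ract T (N a) c.

(** N lies in the norm closure of Q. *)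
Definition operator_limit (Q : {linear A -> T} -> Prop) (N : A -> T) :=
  forall e, 0 < e -> exists2 N' : {linear A -> T}, Q N' &
    forall x, rnorm (N x - N' x) <= e * rnorm x.

Lemma operator_limit_bounded (Q : {linear A -> T} -> Prop) N :
  (forall N', Q N' -> bounded_map N') -> operator_limit Q N -> bounded_map N.
Proof.
move=> Qb /(_ _ ltr01)[N' /Qb[M M0 NM] NN'].
exists (1 + M) => [|x]; first by rewrite addr_ge0.
by rewrite -[N x](subrK (N' x)) (le_trans (rnormD _ _))// mulrDl lerD.
Qed.

Lemma operator_limit_inherits_right (Q : {linear A -> T} -> Prop) N :
  (forall N', Q N' -> inherits_right N') -> operator_limit Q N ->
  inherits_right N.
Proof.
move=> Qi NQ c rc a; have [C C0 TC] := ract_bound T.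
apply/eqP; rewrite -subr_eq0; apply/eqP.
apply: (@rnorm_small _ _ _ (rnorm (a ∗ c) + C * (rnorm a * rnorm c))) => e e0.
have [N' /Qi/(_ c rc a) N'c NN'] := NQ e e0.
have -> : N (a ∗ c) - ract T (N a) c =
    (N (a ∗ c) - N' (a ∗ c)) - ract T (N a - N' a) c.
  by rewrite linearBl /= N'c opprB addrA subrK.
rewrite (le_trans (rnormB _ _))// mulrDr lerD// (le_trans (TC _ _))//.
by rewrite [leRHS]mulrCA ler_wpM2l// mulrA ler_wpM2r ?rnorm_ge0.
Qed.

(** A Neumann series: N + rho o (1 - p o N) replaces 1 - p o N by
(1 - p o rho) o (1 - p o N). All iterates commute with the right action
of c as soon as rho does. *)
Lemma right_inverse_of_approx (e : R) : 0 <= e < 1 ->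
  (forall a, rnorm (a - p (rho a)) <= e * rnorm a) ->
  exists N : {linear A -> T},
    [/\ bounded_map N, forall a, p (N a) = a & inherits_right N].
Proof.
move=> e01 rhoe; have [e0 _] := andP e01; have [M M0 rhoM] := rho_bounded.
have [K K0 pK] := ts_prod_bounded tsq.
pose P (N : {linear A -> T}) (l : R) :=
  [/\ bounded_map N, forall a, rnorm (a - p (N a)) <= l * rnorm a &
      inherits_right N].
have step (N : {linear A -> T}) l : 0 <= l -> P N l ->
    exists2 N' : {linear A -> T}, P N' (e * l) &
    forall x, rnorm (N' x - N x) <= M * l * rnorm x.
  move=> l0 [bN Nl Nc].
  pose N' : {linear A -> T} := N \+ (rho \o (idfun \- (p \o N))).
  have N'E a : N' a = N a + rho (a - p (N a)) by [].
  exists N'; last first.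
    by move=> x; rewrite N'E addrC addKr (le_trans (rhoM _))// -mulrA ler_wpM2l.
  split.
  - apply: bounded_add => //; apply: bounded_comp => //; apply: bounded_sub.
      exact: bounded_id.
    by apply: bounded_comp => //; exact: ts_prod_bounded tsq.
  - move=> a; rewrite N'E [p _]linearD opprD addrA (le_trans (rhoe _))//.
    by rewrite -mulrA ler_wpM2l.
  - move=> c rc a; rewrite !N'E (Nc c rc) ts_prod_ract -linearBl /=.
    by rewrite rc -linearDl.
have P0 : P \0 1.
  split; first exact: bounded_zero.
    by move=> a; rewrite /= linear0 subr0 mul1r.
  by move=> c _ a; rewrite /= linear0l.
have [N NP] := geometric_iteration e01 M0 step ler01 P0.
have NL : operator_limit (fun N' => exists l, P N' l) N.
  move=> d /NP[N' [l [_ PN' NN']]]; exists N' => //; exists l; exact: PN'.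
exists N; split.
- by apply: operator_limit_bounded NL => N' [l []].
- move=> a; apply/esym/eqP; rewrite -subr_eq0; apply/eqP.
  apply: (@rnorm_small _ _ _ ((1 + K) * rnorm a)) => d d0.
  have [N' [l [/andP[_ ld] [_ N'l _] NN']]] := NP d d0.
  have -> : a - p (N a) = (a - p (N' a)) - p (N a - N' a).
    by rewrite linearB /= opprB addrA subrK.
  rewrite (le_trans (rnormB _ _))// mulrDl mul1r mulrDr lerD//.
    by rewrite (le_trans (N'l a))// ler_wpM2r ?rnorm_ge0.
  by rewrite (le_trans (pK _))// [leRHS]mulrCA ler_wpM2l.
- by apply: operator_limit_inherits_right NL => N' [l []].
Qed.

(** The second clause is the cocycle identity
c d(x, y) = d(c x, y) - d(c, x y), extended from elementary tensors; it expresses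
how far L is from a left module morphism. *)
Lemma left_defect_lift (N : {linear A -> T}) (l : R) : 0 <= l ->
  bounded_map N ->
  (forall x y, rnorm (left_defect N x y) <= l * (rnorm x * rnorm y)) ->
  exists L : {linear T -> T},
    [/\ forall t, rnorm (L t) <= l * rnorm t,
        forall a t, lact T a (L t) = L (lact T a t) - left_defect N a (p t),
        (forall a, p (N a) = a) -> forall t, p (L t) = 0 &
        forall c, (forall a, N (a ∗ c) = ract T (N a) c) ->
          forall t, L (ract T t c) = ract T (L t) c].
Proof.
move=> l0 bN Nl; have [B BE] := pack_bilinear (left_defect_bilinear N).
have [|L Lj Ll] := ts_lift tsq (B := B) l0.
  by move=> x y; rewrite BE Nl.
have {}Lj x y : L (j x y) = left_defect N x y by rewrite Lj BE.
have bL : bounded_map L by exists l.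
have bp := ts_prod_bounded tsq.
exists L; split => //.
- move=> a; apply: ts_ext_fun => [k t u|k t u| | |x y].
  + by rewrite linearP linearPr.
  + have Nlin : linear (left_defect N a) := (left_defect_bilinear N).2 a.
    by rewrite [p _]linearP Nlin linearPr linearP /= opprD addrACA -scalerBr.
  + by apply: bounded_comp => //; exact: lact_bounded.
  + apply: bounded_sub; first by apply: bounded_comp => //; exact: lact_bounded.
    apply: (@bounded_comp _ _ _ _ (left_defect N a) p) => //.
    apply: bounded_sub; apply: bounded_comp => //.
      exact: mul_bounded.
    exact: lact_bounded.
  + rewrite (ts_lact tsq) !Lj (ts_prod tsq) /left_defect linearBr /=.
    by rewrite lactA !ba_mulA opprB [RHS]addrC addrA subrK.
- move=> pN; apply: ts_ext_fun => [k t u|k t u| | |x y].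
  + by rewrite !linearP.
  + by rewrite scaler0 addr0.
  + exact: bounded_comp.
  + exact: bounded_zero.
  + by rewrite Lj linearB /= ts_prod_lact !pN subrr.
- move=> c Nc; apply: ts_ext_fun => [k t u|k t u| | |x y].
  + by rewrite linearPl linearP.
  + by rewrite linearP linearPl.
  + by apply: bounded_comp => //; exact: ract_bounded.
  + by apply: (@bounded_comp _ _ _ _ ((ract T)^~ c) L) => //; exact: ract_bounded.
  + by rewrite (ts_ract tsq) !Lj /left_defect linearBl /= ba_mulA !Nc lractA.
Qed.

(** Corrections preserve p o N = 1 because p o L = 0 once p o N = 1, so exactness
is reached without any control on the norm of rho. The bound e + e is the sum
of the error of rho as a module morphism and its error as a section. *)
Lemma averaging (e : R) : 0 <= e -> e + e < 1 ->
  (forall c a, rnorm (left_defect rho c a) <= e * (rnorm c * rnorm a)) ->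
  (forall a, rnorm (a - p (rho a)) <= e * rnorm a) ->
  exists N : {linear A -> T},
    [/\ bounded_map N, forall a, p (N a) = a,
        forall c a, N (c ∗ a) = lact T c (N a) & inherits_right N].
Proof.
move=> e0 ee rhod rhoe; have [M M0 rhoM] := rho_bounded.
have [|N0 [bN0 pN0 iN0]] := right_inverse_of_approx _ rhoe.
  by rewrite e0 (le_lt_trans _ ee)// lerDl.
have [C C0 TC] := lact_bound T.
pose P (N : {linear A -> T}) (l : R) :=
  [/\ bounded_map N, forall a, p (N a) = a, inherits_right N &
      forall x y, rnorm (left_defect N x y) <= l * (rnorm x * rnorm y)].
have step (N : {linear A -> T}) l : 0 <= l -> P N l ->
    exists2 N' : {linear A -> T}, P N' ((e + e) * l) &
    forall x, rnorm (N' x - N x) <= M * l * rnorm x.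
  move=> l0 [bN pN iN Nl].
  have [L [Ll Lact pL Lr]] := left_defect_lift l0 bN Nl.
  have bL : bounded_map L by exists l.
  pose N' : {linear A -> T} := N \- (L \o rho).
  have N'E a : N' a = N a - L (rho a) by [].
  exists N'; last first.
    move=> x; rewrite N'E addrC addKr -[rnorm _](congr1 _ (normrN _)) opprK.
    by rewrite (le_trans (Ll _))// [M * l]mulrC -mulrA ler_wpM2l.
  split.
  - by apply: bounded_sub => //; exact: bounded_comp.
  - by move=> a; rewrite N'E linearB /= pN (pL pN) subr0.
  - by move=> c rc a; rewrite !N'E rc (iN c rc) Lr ?linearBl//; exact: iN.
  - move=> x y.
    have -> : left_defect N' x y =
        left_defect N x (y - p (rho y)) - L (left_defect rho x y).
      have Ld : L (left_defect rho x y) = L (rho (x ∗ y)) - L (lact T x (rho y)).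
        by rewrite -linearB.
      rewrite left_defectBr Ld.
      rewrite -[left_defect N' x y]/(N' (x ∗ y) - lact T x (N' y)) !N'E.
      rewrite [lact T x _]linearB /= Lact.
      rewrite -[left_defect N x y]/(N (x ∗ y) - lact T x (N y)) !opprB.
      by rewrite [RHS](AC (3*2) (1*5*(4*3*2))).
    rewrite (le_trans (rnormB _ _))// !mulrDl lerD//.
      rewrite (le_trans (Nl _ _))// [e * l]mulrC -mulrA ler_wpM2l//.
      by rewrite mulrCA ler_wpM2l ?rnorm_ge0.
    by rewrite (le_trans (Ll _))// [e * l]mulrC -mulrA ler_wpM2l.
have PN0 : exists2 l, 0 <= l & P N0 l.
  have [K K0 NK] := bN0; exists (K + C * K); first by rewrite addr_ge0// mulr_ge0.
  split=> // x y; rewrite (le_trans (rnormB _ _))// mulrDl lerD//.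
    by rewrite (le_trans (NK _))// ler_wpM2l ?rnorm_mul.
  by rewrite (le_trans (TC _ _))// -mulrA ler_wpM2l// mulrCA ler_wpM2l ?rnorm_ge0.
have [l0 l00 {}PN0] := PN0.
have [|N NP] := geometric_iteration _ M0 step l00 PN0.
  by rewrite addr_ge0.
have NL : operator_limit (fun N' => exists l, P N' l) N.
  move=> d /NP[N' [l [_ PN' NN']]]; exists N' => //; exists l; exact: PN'.
have [K K0 pK] := ts_prod_bounded tsq.
exists N; split.
- by apply: operator_limit_bounded NL => N' [l []].
- move=> a; apply/esym/eqP; rewrite -subr_eq0; apply/eqP.
  apply: (@rnorm_small _ _ _ (K * rnorm a)) => d d0.
  have [N' [l [/andP[_ ld] [_ pN' _ _] NN']]] := NP d d0.
  rewrite -{1}(pN' a) -linearB (le_trans (pK _))// rnorm_distC.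
  by rewrite [leRHS]mulrCA ler_wpM2l.
- move=> c a; apply/eqP; rewrite -subr_eq0; apply/eqP.
  apply: (@rnorm_small _ _ _ (rnorm (c ∗ a) + rnorm c * rnorm a +
    C * (rnorm c * rnorm a))) => d d0.
  have [N' [l [/andP[_ ld] [_ _ _ N'l] NN']]] := NP d d0.
  have -> : N (c ∗ a) - lact T c (N a) = (N (c ∗ a) - N' (c ∗ a)) +
      left_defect N' c a - lact T c (N a - N' a).
    rewrite linearBr /= opprB -[left_defect N' c a]/(_ - _).
    by rewrite [_ - _ + (_ - _)]addrA subrK addrA subrK.
  rewrite (le_trans (rnormB _ _))// mulrDr lerD//.
    rewrite (le_trans (rnormD _ _))// mulrDr lerD//.
    by rewrite (le_trans (N'l _ _))// ler_wpM2r// mulr_ge0 ?rnorm_ge0.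
  rewrite (le_trans (TC _ _))// [leRHS]mulrCA ler_wpM2l//.
  by rewrite mulrCA ler_wpM2l ?rnorm_ge0.
- by apply: operator_limit_inherits_right NL => N' [l []].
Qed.

End Averaging.
End TensorSquare.

(** * Exact two-sided sections *)

Section Opposite.
Variables (R : realType) (A : banachAlgebra R).

Lemma swap_continuous (U V W : normedModType R[i]) (f : U -> V -> W) :
  continuous (fun q : U * V => f q.1 q.2) ->
  continuous (fun q : V * U => f q.2 q.1).
Proof.
move=> cf [v u].
have sw : (fun q : V * U => (q.2, q.1)) @ (v, u) --> (u, v).
  by apply: cvg_pair; [exact: cvg_snd|exact: cvg_fst].
exact: (cvg_comp _ _ sw (cf (u, v))).
Qed.

Lemma swap_bilinear (U V W : normedModType R[i]) (f : {bilinear U -> V -> W}) :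
  bilinear_for *:%R *:%R (fun v u => f u v).
Proof. by split=> [u|v] k x y /=; rewrite ?linearPr ?linearPl. Qed.

Definition swap_bilinear_map (U V W : normedModType R[i])
    (f : {bilinear U -> V -> W}) : {bilinear V -> U -> W} :=
  HB.pack (fun v u => f u v)
    (bilinear_isBilinear.Build R[i] V U W _ _ (fun v u => f u v) (swap_bilinear f)).

(** Right module statements are left module statements here, so that averaging
needs to be carried out on one side only. *)
Definition opposite_algebra : banachAlgebra R :=
  @BanachAlgebra R A (swap_bilinear_map (ba_mul A))
    (fun x y z => esym (ba_mulA z y x))
    (fun a b => eq_ind_r (fun r => _ <= r) (ba_normM b a) (mulrC _ _)).

Definition opposite_bimodule (X : banachBimodule A) :
    banachBimodule opposite_algebra :=
  @BanachBimodule R opposite_algebra X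
    (swap_bilinear_map (ract X)) (swap_bilinear_map (lact X))
    (swap_continuous (@ract_continuous _ _ X))
    (swap_continuous (@lact_continuous _ _ X))
    (fun a b x => @ractA R A X x b a) (fun x a b => @lactA R A X b a x)
    (fun a x b => esym (@lractA R A X b x a)).

Lemma opposite_tensor_square (T : banachBimodule A) (j : A -> A -> T)
    (p : {linear T -> A}) : tensor_square j p ->
  @tensor_square R opposite_algebra (opposite_bimodule T) (fun x y => j y x) p.
Proof.
move=> tsq; split=> [Z B M M0 BM|Z f g bf bg fg||x y|a x y|a x y].
- have [|L Lj LM] := ts_lift tsq (B := swap_bilinear_map B) M0.
    by move=> x y; rewrite [rnorm x * _]mulrC; exact: BM.
  by exists L => // x y; exact: Lj.
- by apply: (ts_ext tsq) => // x y; exact: fg.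
- exact: ts_prod_bounded tsq.
- exact: ts_prod tsq y x.
- exact: ts_ract tsq a y x.
- exact: ts_lact tsq a y x.
Qed.
End Opposite.

Section ExactSection.
Variables (R : realType) (A : banachAlgebra R) (T : banachBimodule A).
Variables (j : A -> A -> T) (p : {linear T -> A}).
Hypothesis tsq : tensor_square j p.

Definition right_defect (N : A -> T) x y := N (x ∗ y) - ract T (N x) y.

Lemma left_defect_opposite (N : A -> T) (c a : A) :
  @left_defect R (opposite_algebra A) (opposite_bimodule T) N c a =
  right_defect N a c.
Proof. by []. Qed.

(** With an exact section s, one step of the averaging already kills the defect,
and it moves rho by no more than the defect times the norm of s. *)
Lemma left_correction (s : {linear A -> T}) (K : R) :
  (forall a, rnorm (s a) <= K * rnorm a) ->
  (forall a, p (s a) = a) -> (forall c a, s (c ∗ a) = lact T c (s a)) ->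
  forall (rho : {linear A -> T}) (e : R), 0 <= e -> bounded_map rho ->
    (forall c a, rnorm (left_defect rho c a) <= e * (rnorm c * rnorm a)) ->
  exists rho' : {linear A -> T},
    [/\ bounded_map rho', forall c a, rho' (c ∗ a) = lact T c (rho' a) &
        forall a, rnorm (rho' a - rho a) <= e * K * rnorm a].
Proof.
move=> sK ps sl rho e e0 brho rhoe.
have [L [Le Lact _ _]] := left_defect_lift tsq e0 brho rhoe.
pose N : {linear A -> T} := rho \- (L \o s).
have NE a : N a = rho a - L (s a) by [].
have close a : rnorm (N a - rho a) <= e * K * rnorm a.
  rewrite NE addrC addKr -[rnorm _](congr1 _ (normrN _)) opprK.
  by rewrite (le_trans (Le _))// -mulrA ler_wpM2l.
exists N; split=> //.
  have [M M0 rhoM] := brho.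
  exists (`|e * K| + M) => [|a]; first by rewrite addr_ge0.
  rewrite -[N a](subrK (rho a)) (le_trans (rnormD _ _))// mulrDl lerD//.
  by rewrite (le_trans (close a))// ler_wpM2r ?rnorm_ge0// ler_norm.
move=> c a; rewrite !NE linearBr /= Lact ps sl /left_defect.
by rewrite opprB [RHS]addrA [lact T c (rho a) + _]addrC subrK.
Qed.

(** The order of choices matters: s is fixed first, and only then e, small with
respect to the norms of s, p and the right action. *)
Lemma exact_section :
  (forall e : R, 0 < e -> exists rho : {linear A -> T},
    [/\ bounded_map rho,
        forall c a, rnorm (left_defect rho c a) <= e * (rnorm c * rnorm a),
        forall a c, rnorm (right_defect rho a c) <= e * (rnorm a * rnorm c) &
        forall a, rnorm (a - p (rho a)) <= e * rnorm a]) ->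
  exists N : {linear A -> T},
    [/\ bounded_map N, forall a, p (N a) = a,
        forall c a, N (c ∗ a) = lact T c (N a) &
        forall a c, N (a ∗ c) = ract T (N a) c].
Proof.
move=> approx.
have q3 : 0 < 3^-1 :> R by rewrite invr_gt0.
have [rho1 [brho1 rho1l _ rho1p]] := approx _ q3.
have [|s [[K K0 sK] ps sl _]] := averaging tsq brho1 (ltW q3) _ rho1l rho1p.
  lra.
have [P P0 pP] := ts_prod_bounded tsq; have [C C0 TC] := ract_bound T.
(* Both errors of the corrected operator are at most e D = 1 / 3. *)
pose D := 1 + K + C * K + P * K.
have D0 : 0 < D by rewrite /D -!addrA ltr_pwDl// !addr_ge0// mulr_ge0.
have e0 : 0 < 3^-1 / D by rewrite divr_gt0.
set e := 3^-1 / D in e0.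
have [rho [brho rhol rhor rhop]] := approx _ e0.
have [rho' [brho' rho'l close]] := left_correction sK ps sl (ltW e0) brho rhol.
have eD : e * D = 3^-1 by rewrite divfK// gt_eqF.
have eK : 0 <= e * K by rewrite mulr_ge0// ltW.
clearbody e.
have tsqop := opposite_tensor_square tsq.
have [| | |N [bN pN Nr Nl]] := averaging tsqop (rho := rho') brho' (ltW q3).
- lra.
- move=> c a; rewrite left_defect_opposite.
  have -> : right_defect rho' a c = (rho' (ba_mul A a c) - rho (ba_mul A a c))
      + right_defect rho a c - ract T (rho' a - rho a) c.
    rewrite linearBl /= opprB.
    rewrite -[right_defect rho a c]/(rho (ba_mul A a c) - ract T (rho a) c).
    by rewrite [_ - _ + (_ - _)]addrA subrK addrA subrK.
  have rr : 0 <= rnorm c * rnorm a by rewrite mulr_ge0 ?rnorm_ge0.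
  rewrite (le_trans (rnormB _ _))//.
  rewrite (le_trans (lerD (rnormD _ _) (TC _ _)))//.
  have h1 := close (ba_mul A a c); have h2 := rhor a c; have h3 := close a.
  have h4 := ler_wpM2l eK (@rnorm_mul R A a c).
  have h5 := ler_wpM2l C0 (ler_wpM2r (rnorm_ge0 c) h3).
  have h6 := lerD (lerD (le_trans h1 h4) h2) h5; apply: (le_trans h6).
  rewrite -eD -subr_ge0 [X in 0 <= X](_ : _ = e * (P * K * (rnorm c * rnorm a))).
    by rewrite mulr_ge0 ?(ltW e0)// mulr_ge0// mulr_ge0.
  by rewrite /D; ring.
- move=> a.
  have -> : a - p (rho' a) = (a - p (rho a)) - p (rho' a - rho a).
    by rewrite linearB /= opprB addrA subrK.
  rewrite (le_trans (rnormB _ _))//.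
  rewrite (le_trans (lerD (rhop _) (pP _)))//.
  have h3 := ler_wpM2l P0 (close a).
  rewrite (le_trans (lerD (lexx _) h3))// -eD -subr_ge0.
  rewrite [X in 0 <= X](_ : _ = e * ((K + C * K) * rnorm a)).
    by rewrite !mulr_ge0 ?addr_ge0 ?mulr_ge0 ?rnorm_ge0// ltW.
  by rewrite /D; ring.
exists N; split=> //; move=> c a.
- by apply: (Nl c) => b; exact: rho'l.
- exact: Nr.
Qed.

End ExactSection.

(** * Biprojectivity from a section *)

Section Projectivity.
Variables (R : realType) (A : banachAlgebra R).

(** The lift is F o N, where G averages s o phi from the left, and F averages
G o N from the right. *)
Lemma exact_section_biprojective (T : banachBimodule A) (j : A -> A -> T)
    (p : {linear T -> A}) : tensor_square j p ->
  (exists N : {linear A -> T},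
    [/\ bounded_map N, forall a, p (N a) = a,
        forall c a, N (c ∗ a) = lact T c (N a) &
        forall a c, N (a ∗ c) = ract T (N a) c]) ->
  biprojective A.
Proof.
move=> tsq [N [bN pN Nl Nr]] X Y sigma phi [[csigma sl sr] _ [s cs sK]] [cphi pl pr].
have pl' (a x : A) : phi (ba_mul A a x) = lact Y a (phi x) := pl a x.
have pr' (x a : A) : phi (ba_mul A x a) = ract Y (phi x) a := pr x a.
have bsigma : bounded_map sigma by exact/bounded_mapP.
have bphi : bounded_map phi by exact/bounded_mapP.
have bp := ts_prod_bounded tsq.
have [S S0 sS] : bounded_map (s \o phi).
  by apply: bounded_comp => //; exact/bounded_mapP.
have [C C0 XC] := lact_bound X; have [E E0 XE] := ract_bound X.
have lB1 : bilinear_for *:%R *:%R (fun x y : A => lact X x (s (phi y))).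
  by split=> [y|x] k u v /=; [rewrite linearPl|rewrite !linearP].
have [B1 B1E] := pack_bilinear lB1.
have [|G Gj GM] := ts_lift tsq (B := B1) (M := C * S) (mulr_ge0 C0 S0).
  move=> x y; rewrite B1E (le_trans (XC _ _))// -mulrA ler_wpM2l//.
  by rewrite mulrCA ler_wpM2l ?rnorm_ge0//; exact: sS.
have {B1 B1E lB1} Gj x y : G (j x y) = lact X x (s (phi y)) by rewrite Gj B1E.
have bG : bounded_map G by exists (C * S) => //; exact: mulr_ge0.
have Gl a t : G (lact T a t) = lact X a (G t).
  move: t; apply: (ts_ext_fun tsq) => [k t u|k t u| | |x y].
  - by rewrite linearPr linearP.
  - by rewrite linearP linearPr.
  - by apply: bounded_comp => //; exact: lact_bounded.
  - by apply: bounded_comp => //; exact: lact_bounded.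
  - by rewrite (ts_lact tsq) !Gj lactA.
have sG t : sigma (G t) = phi (p t).
  move: t; apply: (ts_ext_fun tsq) => [k t u|k t u| | |x y].
  - by rewrite !linearP.
  - by rewrite !linearP.
  - exact: bounded_comp.
  - exact: (@bounded_comp _ _ _ _ phi p).
  - by rewrite Gj sl sK (ts_prod tsq) pl'.
have [K K0 GN] : bounded_map (G \o N) by exact: bounded_comp.
have lB2 : bilinear_for *:%R *:%R (fun x z : A => ract X (G (N x)) z).
  by split=> [y|x] k u v /=; [rewrite !linearP linearPl|rewrite linearPr].
have [B2 B2E] := pack_bilinear lB2.
have [|F Fj FM] := ts_lift tsq (B := B2) (M := E * K) (mulr_ge0 E0 K0).
  move=> x y; rewrite B2E (le_trans (XE _ _))// -mulrA ler_wpM2l// mulrA.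
  by rewrite ler_wpM2r ?rnorm_ge0//; exact: GN.
have {B2 B2E lB2} Fj x y : F (j x y) = ract X (G (N x)) y by rewrite Fj B2E.
have bF : bounded_map F by exists (E * K) => //; exact: mulr_ge0.
have Fl a t : F (lact T a t) = lact X a (F t).
  move: t; apply: (ts_ext_fun tsq) => [k t u|k t u| | |x y].
  - by rewrite linearPr linearP.
  - by rewrite linearP linearPr.
  - by apply: bounded_comp => //; exact: lact_bounded.
  - by apply: bounded_comp => //; exact: lact_bounded.
  - by rewrite (ts_lact tsq) !Fj Nl Gl lractA.
have Fr a t : F (ract T t a) = ract X (F t) a.
  move: t; apply: (ts_ext_fun tsq) => [k t u|k t u| | |x y].
  - by rewrite linearPl linearP.
  - by rewrite linearP linearPl.
  - by apply: bounded_comp => //; exact: ract_bounded.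
  - by apply: (@bounded_comp _ _ _ _ ((ract X)^~ a) F) => //; exact: ract_bounded.
  - by rewrite (ts_ract tsq) !Fj ractA.
have sF t : sigma (F t) = phi (p t).
  move: t; apply: (ts_ext_fun tsq) => [k t u|k t u| | |x y].
  - by rewrite !linearP.
  - by rewrite !linearP.
  - exact: bounded_comp.
  - exact: (@bounded_comp _ _ _ _ phi p).
  - by rewrite Fj sr sG pN (ts_prod tsq) pr'.
exists (F \o N : {linear regular_bimodule A -> X}); last first.
  by move=> x; rewrite /= sF pN.
split.
- by apply/bounded_mapP; exact: bounded_comp.
- by move=> a x; rewrite /= -Fl; congr (F _); exact: Nl.
- by move=> x a; rewrite /= -Fr; congr (F _); exact: Nr.
Qed.

Local Notation T := (tensor_bimodule A).

Lemma product_map_linear : linear (@product_map R A).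
Proof.
apply: (@plift_linear _ _ _ _ (ba_mul A) 1) => a b.
by rewrite mul1r; exact: rnorm_mul.
Qed.

Definition product_lin : {linear T -> A} :=
  HB.pack (@product_map R A)
    (GRing.isLinear.Build _ _ _ _ (@product_map R A) product_map_linear).

Lemma projective_tensor_square :
  @tensor_square R A T (@tens R A A) product_lin.
Proof.
split=> [Z B M M0 BM|Z f g bf bg fg||||].
- have [L LE] := pack_linear (plift_linear BM).
  exists L => [x y|t]; rewrite LE; first exact: plift_tens BM x y.
  by have := plift_bound BM t; rewrite ger0_norm.
- by apply: ptensor_ext fg; [exact: linearP|exact: linearP| |];
    exact: bounded_map_weak.
- exists 1 => // t; have := @plift_bound _ _ _ _ (ba_mul A) 1 _ t.
  by rewrite normr1; apply=> a b; rewrite mul1r; exact: rnorm_mul.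
- exact: product_map_tens.
- exact: tensor_lact_tens.
- exact: tensor_ract_tens.
Qed.

Lemma unit_ball_bounded (V : normedModType R[i]) :
  bounded_set [set x : V | rnorm x <= 1].
Proof.
exists 1; split; first exact: real1.
move=> M M1 x /= x1; apply: le_trans (ltW M1).
by rewrite -rnormE -[1]/(1%:C%C) lecR.
Qed.

Lemma approximate_section_bounds (D : directedSet)
    (rho : D -> {linear regular_bimodule A -> T}) :
  uniform_approx_morphism rho ->
  opnorm (fun a : A => product_map (rho nu a) - a) @[nu --> tails D] --> (0 : R) ->
  forall e : R, 0 < e -> exists rho : {linear A -> T},
    [/\ bounded_map rho,
        forall c a, rnorm (left_defect rho c a) <= e * (rnorm c * rnorm a),
        forall a c, rnorm (right_defect rho a c) <= e * (rnorm a * rnorm c) &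
        forall a, rnorm (a - product_lin (rho a)) <= e * rnorm a].
Proof.
move=> [crho rhoM] /cvgrPdist_lt pirho e e0.
have bA := unit_ball_bounded A.
have /(filterI (pirho e e0)) := rhoM _ _ bA bA e e0.
move=> /filter_ex[nu [/= nupi nuM]].
pose r : {linear A -> T} := rho nu.
have br : bounded_map r by apply/bounded_mapP; exact: crho.
exists r; split => //.
- have [B BE] := pack_bilinear (left_defect_bilinear r).
  have := bilinear_bound_of_unit (f := B) (c := e) ltr01.
  rewrite expr1n divr1 => H c a; rewrite -BE; apply: H => x y x1 y1.
  by rewrite BE; apply/ltW; exact: (proj1 (nuM x y x1 y1)).
- have lB : bilinear_for *:%R *:%R (right_defect r).
    rewrite /right_defect; split=> [y|x] k u v /=.
      by rewrite linearPl !linearP linearPl /= opprD addrACA -scalerBr.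
    by rewrite linearPr !linearP linearPr /= opprD addrACA -scalerBr.
  have [B BE] := pack_bilinear lB.
  have := bilinear_bound_of_unit (f := B) (c := e) ltr01.
  rewrite expr1n divr1 => H c a; rewrite -BE; apply: H => x y x1 y1.
  by rewrite BE; apply/ltW; exact: (proj2 (nuM y x y1 x1)).
- move=> a; pose f : {linear A -> A} := (product_lin \o r) \- idfun.
  have bf : bounded_map f.
    apply: bounded_sub; last exact: bounded_id.
    apply: bounded_comp => //; exact: ts_prod_bounded projective_tensor_square.
  rewrite rnorm_distC (le_trans (opnorm_le bf a))// ler_wpM2r ?rnorm_ge0//.
  rewrite (le_trans (ler_norm _))// ltW//.
  by move: nupi; rewrite sub0r normrN.
Qed.

End Projectivity.

(** * Norming functionals *)

Section HahnBanach.
Variables (R : realType) (V : normedModType R[i]).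
Local Notation "t %:C" := (real_complex R t).

Section RealFunctional.
Variable x0 : V.

(** Functionals on real subspaces are represented by their graphs, so that
extension is inclusion and Zorn applies to unions of chains. The last clause is
conditional because the union of the empty chain has to qualify. *)
Let graph (G : set (V * R)) :=
  [/\ forall t v r w s, G (v, r) -> G (w, s) -> G (t%:C *: v + w, t * r + s),
      forall v r, G (v, r) -> r <= rnorm v &
      G !=set0 -> G (x0, rnorm x0)].

Let rnormZr (t : R) (v : V) : rnorm (t%:C *: v) = `|t| * rnorm v.
Proof. by rewrite rnormZ rnorm_real. Qed.

Let graph_chain (F : set (set (V * R))) : F `<=` graph ->
  total_on F subset -> graph (\bigcup_(X in F) X).
Proof.
move=> Fg tot; split.
- move=> t v r w s [X FX Xv] [Y FY Yw].
  have [XY|YX] := tot _ _ FX FY.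
    by exists Y => //; have [Yl _ _] := Fg _ FY; apply: Yl => //; exact: XY.
  by exists X => //; have [Xl _ _] := Fg _ FX; apply: Xl => //; exact: YX.
- by move=> v r [X FX Xv]; have [_ Xd _] := Fg _ FX; exact: Xd.
- move=> [z [X FX Xz]]; exists X => //; have [_ _ X0] := Fg _ FX.
  by apply: X0; exists z.
Qed.

Let graph_line : graph [set z | exists t : R, z = (t%:C *: x0, t * rnorm x0)].
Proof.
split.
- move=> t v r w s [a [-> ->]] [b [-> ->]]; exists (t * a + b).
  by rewrite rmorphD rmorphM /= scalerDl scalerA mulrDl mulrA.
- move=> v r [t [-> ->]]; rewrite rnormZr ler_wpM2r ?rnorm_ge0//.
  exact: ler_norm.
- by move=> _; exists 1; rewrite scale1r mul1r.
Qed.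

Let graph0 G : graph G -> G !=set0 -> G (0, 0).
Proof.
move=> [Gl _ G0] /G0 Gx; have := Gl (-1) _ _ _ _ Gx Gx.
by rewrite rmorphN rmorph1 scaleN1r mulN1r !addNr.
Qed.

Let graph_extend G (v : V) : graph G -> G !=set0 ->
  exists2 G', graph G' & G `<=` G' /\ exists r, G' (v, r).
Proof.
move=> Gg Gn; have [Gl Gd G0] := Gg; have Gz := graph0 Gg Gn.
have bnd w r w' r' : G (w, r) -> G (w', r') ->
    r - rnorm (w - v) <= rnorm (w' + v) - r'.
  move=> Gw Gw'; have /Gd := Gl 1 _ _ _ _ Gw Gw'.
  rewrite rmorph1 scale1r mul1r => rw.
  have := rnormD (w - v) (w' + v); rewrite addrACA addNr addr0; lra.
pose S := [set z.2 - rnorm (z.1 - v) | z in G].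
have Subd w r : G (w, r) -> ubound S (rnorm (w + v) - r).
  by move=> Gw _ [[w' r'] /= Gw' <-]; exact: bnd.
have Sn : S !=set0 by exists (0 - rnorm (0 - v)), (0, 0).
(* The value at v: any number between the two families of bounds will do. *)
pose c := sup S.
have cl w r : G (w, r) -> r - rnorm (w - v) <= c.
  move=> Gw; apply: ub_le_sup; last by exists (w, r).
  by exists (rnorm (0 + v) - 0); exact: Subd.
have cu w r : G (w, r) -> c <= rnorm (w + v) - r.
  by move=> Gw; apply: ge_sup => //; exact: Subd.
have Gsc t w r : G (w, r) -> G (t%:C *: w, t * r).
  by move=> Gw; have := Gl t _ _ _ _ Gw Gz; rewrite !addr0.
exists [set z | exists t w r, G (w, r) /\ z = (w + t%:C *: v, r + t * c)];
  last first.
  split=> [[w r] Gw|].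
    by exists 0, w, r; split=> //; rewrite scale0r mul0r !addr0.
  by exists c, 1, 0, 0; split=> //; rewrite scale1r mul1r !add0r.
split.
- move=> t _ _ _ _ [a [w [r [Gw [-> ->]]]]] [b [w' [r' [Gw' [-> ->]]]]].
  exists (t * a + b), (t%:C *: w + w'), (t * r + r'); split; first exact: Gl.
  congr pair; last by ring.
  by rewrite rmorphD rmorphM /= scalerDl scalerDr scalerA addrACA.
- move=> _ _ [t [w [r [Gw [-> ->]]]]].
  have [t0|t0|->] := ltgtP t 0; last by rewrite scale0r mul0r !addr0; exact: Gd.
  + have s0 : 0 < - t by rewrite oppr_gt0.
    have := cl _ _ (Gsc (- t)^-1 _ _ Gw).
    rewrite -(ler_pM2l s0) mulrBr mulVKf ?gt_eqF//.
    rewrite -[X in _ - X](_ : rnorm ((- t)%:C *: ((- t)^-1%:C *: w - v)) = _);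
      last by rewrite rnormZr gtr0_norm.
    rewrite scalerBr scalerA -rmorphM mulfV ?gt_eqF// scale1r rmorphN scaleNr opprK.
    by lra.
  + have := cu _ _ (Gsc t^-1 _ _ Gw).
    rewrite -(ler_pM2l t0) mulrBr mulVKf ?gt_eqF//.
    rewrite -[X in X - _](_ : rnorm (t%:C *: (t^-1%:C *: w + v)) = _); last first.
      by rewrite rnormZr gtr0_norm.
    rewrite scalerDr scalerA -rmorphM mulfV ?gt_eqF// scale1r.
    by lra.
- move=> _; exists 0, x0, (rnorm x0); split; first exact: G0.
  by rewrite scale0r mul0r !addr0.
Qed.

Lemma real_norming_functional : exists f : V -> R,
  [/\ forall t v w, f (t%:C *: v + w) = t * f v + f w,
      forall v, f v <= rnorm v & f x0 = rnorm x0].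
Proof.
have [G [Gg Gmax]] := Zorn_bigcup graph_chain.
have Gn : G !=set0.
  apply/set0P/negP => /eqP G0; apply: (Gmax _ _ graph_line).
  rewrite G0 properEneq; split; last exact: sub0set.
  apply/eqP => /esym/eqP; apply/negP/set0P; exists (0, 0), 0.
  by rewrite scale0r mul0r.
have [Gl Gd G0] := Gg.
have /choice[f Gf] v : exists r, G (v, r).
  have [G' G'g [GG' [r G'v]]] := graph_extend v Gg Gn.
  have [->|GnG'] := eqVneq G G'; first by exists r.
  by exfalso; apply: (Gmax G') => //; rewrite properEneq.
have fun_ v r s : G (v, r) -> G (v, s) -> r <= s.
  move=> Gr Gs; have /Gd := Gl (-1) _ _ _ _ Gs Gr.
  by rewrite rmorphN rmorph1 scaleN1r mulN1r addNr rnorm0 addrC subr_le0.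
have fE v r : G (v, r) -> f v = r.
  by move=> Gv; apply/eqP; rewrite eq_le !(fun_ v).
exists f; split.
- by move=> t v w; apply: fE; exact: Gl.
- by move=> v; exact: Gd.
- by apply: fE; exact: G0.
Qed.
End RealFunctional.

(** A real functional f with f <= norm and f x = |x| is complexified as
f v - i f (i v), whose real part at x is |x|. *)
Lemma nonzero_functional (x : V) : x != 0 ->
  exists2 g : {linear V -> R[i]^o}, bounded_map g & g x != 0.
Proof.
move=> xn0; have [f [flin fle fx]] := real_norming_functional x.
pose i : R[i] := Complex 0 1.
pose h v : R[i]^o := Complex (f v) (- f (i *: v)).
have scaleE (a b : R) (v : V) :
    Complex a b *: v = a%:C *: v + b%:C *: (i *: v).
  rewrite scalerA -scalerDl; congr (_ *: v).
  by apply/eqP; rewrite eq_complex /=; apply/andP; split; apply/eqP; ring.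
have hlin : linear h.
  move=> [a b] u v; apply/eqP; rewrite eq_complex /= scaleE -addrA !flin.
  have -> : i *: (a%:C *: u + (b%:C *: (i *: u) + v)) =
      a%:C *: (i *: u) + ((- b)%:C *: u + i *: v).
    rewrite !scalerDr !scalerA; congr (_ *: u + (_ *: u + _)).
      by rewrite mulrC.
    by apply/eqP; rewrite eq_complex /=; apply/andP; split; apply/eqP; ring.
  by rewrite !flin; apply/andP; split; apply/eqP; ring.
have fabs v : `|f v| <= rnorm v.
  rewrite ler_norml fle andbT lerNl.
  have f0 : f 0 = 0.
    by have := flin (-1) x x; rewrite rmorphN rmorph1 scaleN1r mulN1r !addNr.
  have := flin (-1) v 0; rewrite f0 rmorphN rmorph1 scaleN1r mulN1r !addr0 => <-.
  by rewrite (le_trans (fle _))// /rnorm normrN.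
have [g gh] := pack_linear hlin; exists g.
  exists 2 => // v; rewrite gh /h /rnorm normc_def /=.
  apply: (@le_trans _ _ (`|f v| + `|f (i *: v)|)); last first.
    rewrite mulr2n mulrDl mul1r lerD// (le_trans (fabs _))// rnormZ.
    by rewrite [rnorm i]/rnorm normc_def /= expr0n expr1n add0r sqrtr1 mul1r.
  rewrite -[leRHS]ger0_norm ?addr_ge0// -sqrtr_sqr ler_wsqrtr// sqrrN.
  rewrite sqrrD !real_normK ?num_real// addrAC lerDl mulrn_wge0// mulr_ge0//.
apply/negP; rewrite gh eq_complex /= fx => /andP[/eqP/rnorm_eq0/eqP].
by rewrite (negbTE xn0).
Qed.
End HahnBanach.

(** * Extensions of bimodules *)

Section ProductBanach.
Variables (R : realType) (U V : completeNormedModType R[i]).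

Local Notation UV := ((U * V)%type : normedModType R[i]).

Lemma prod_complete (F : set_system UV) :
  ProperFilter F -> cauchy F -> cvg F.
Proof.
move=> FF /cauchyP cF.
have c1 : cvg (fst @ F).
  apply/cauchy_cvgP/cauchyP => e e0; have [z Fz] := cF e e0; exists z.1.
  by rewrite /= nbhs_simpl; apply: (@filterS _ F _ (ball z e)) Fz => y [].
have c2 : cvg (snd @ F).
  apply/cauchy_cvgP/cauchyP => e e0; have [z Fz] := cF e e0; exists z.2.
  by rewrite /= nbhs_simpl; apply: (@filterS _ F _ (ball z e)) Fz => y [].
move/cvg_ex : c1 => [a Fa]; move/cvg_ex : c2 => [b Fb].
apply/cvg_ex; exists (a, b).
by move=> S /(cvg_pair Fa Fb); apply: (@filterS _ F) => -[].
Qed.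

HB.instance Definition _ := Uniform_isComplete.Build (U * V)%type prod_complete.

Definition prod_banach : completeNormedModType R[i] := (U * V)%type.
End ProductBanach.

Section Extension.
Variables (R : realType) (A : banachAlgebra R) (Y K : banachBimodule A).
Variables (ml : {bilinear A -> Y -> K}) (mr : {bilinear Y -> A -> K}).
Hypothesis ml_continuous : continuous (fun q : A * Y => ml q.1 q.2).
Hypothesis mr_continuous : continuous (fun q : Y * A => mr q.1 q.2).
Hypothesis mlA : forall a b y,
  ml (a ∗ b) y = ml a (lact Y b y) + lact K a (ml b y).
Hypothesis mrA : forall y a b,
  mr y (a ∗ b) = mr (ract Y y a) b + ract K (mr y a) b.
Hypothesis mlrA : forall a y b,
  mr (lact Y a y) b + ract K (ml a y) b = ml a (ract Y y b) + lact K a (mr y b).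

(** The bimodule structures on Y * K that make K a subbimodule with quotient Y
are given by a pair of cocycles ml and mr. *)
Definition ext_lact (a : A) (x : prod_banach Y K) : prod_banach Y K :=
  (lact Y a x.1, ml a x.1 + lact K a x.2).
Definition ext_ract (x : prod_banach Y K) (a : A) : prod_banach Y K :=
  (ract Y x.1 a, mr x.1 a + ract K x.2 a).

Lemma ext_lact_bilinear : bilinear_for *:%R *:%R ext_lact.
Proof.
split=> [x|a] k u v; apply/pair_equal_spec; split; rewrite /=.
- by rewrite linearPl.
- by rewrite !linearPl scalerDr addrACA.
- by rewrite linearPr.
- by rewrite !linearPr scalerDr addrACA.
Qed.

Lemma ext_ract_bilinear : bilinear_for *:%R *:%R ext_ract.
Proof.
split=> [a|x] k u v; apply/pair_equal_spec; split; rewrite /=.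
- by rewrite linearPl.
- by rewrite !linearPl scalerDr addrACA.
- by rewrite linearPr.
- by rewrite !linearPr scalerDr addrACA.
Qed.

HB.instance Definition _ :=
  bilinear_isBilinear.Build R[i] A (prod_banach Y K) (prod_banach Y K) _ _
    ext_lact ext_lact_bilinear.
HB.instance Definition _ :=
  bilinear_isBilinear.Build R[i] (prod_banach Y K) A (prod_banach Y K) _ _
    ext_ract ext_ract_bilinear.

Lemma ext_lact_continuous :
  continuous (fun q : A * prod_banach Y K => ext_lact q.1 q.2).
Proof.
move=> [a [y k]].
have ca : (fun q : A * prod_banach Y K => q.1) @ (a, (y, k)) --> a by exact: cvg_fst.
have cx : (fun q : A * prod_banach Y K => q.2) @ (a, (y, k)) -->
    ((y, k) : prod_banach Y K).
  exact: cvg_snd.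
have cy : (fun q : A * prod_banach Y K => q.2.1) @ (a, (y, k)) --> y.
  by apply: (cvg_comp _ _ cx); exact: cvg_fst.
have ck : (fun q : A * prod_banach Y K => q.2.2) @ (a, (y, k)) --> k.
  by apply: (cvg_comp _ _ cx); exact: cvg_snd.
apply: cvg_pair.
  exact: (cvg_comp _ _ (cvg_pair ca cy) (@lact_continuous _ _ Y (a, y))).
apply: cvgD.
  exact: (cvg_comp _ _ (cvg_pair ca cy) (@ml_continuous (a, y))).
exact: (cvg_comp _ _ (cvg_pair ca ck) (@lact_continuous _ _ K (a, k))).
Qed.

Lemma ext_ract_continuous :
  continuous (fun q : prod_banach Y K * A => ext_ract q.1 q.2).
Proof.
move=> [[y k] a].
have ca : (fun q : prod_banach Y K * A => q.2) @ ((y, k), a) --> a by exact: cvg_snd.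
have cx : (fun q : prod_banach Y K * A => q.1) @ ((y, k), a) -->
    ((y, k) : prod_banach Y K).
  exact: cvg_fst.
have cy : (fun q : prod_banach Y K * A => q.1.1) @ ((y, k), a) --> y.
  by apply: (cvg_comp _ _ cx); exact: cvg_fst.
have ck : (fun q : prod_banach Y K * A => q.1.2) @ ((y, k), a) --> k.
  by apply: (cvg_comp _ _ cx); exact: cvg_snd.
apply: cvg_pair.
  exact: (cvg_comp _ _ (cvg_pair cy ca) (@ract_continuous _ _ Y (y, a))).
apply: cvgD.
  exact: (cvg_comp _ _ (cvg_pair cy ca) (@mr_continuous (y, a))).
exact: (cvg_comp _ _ (cvg_pair ck ca) (@ract_continuous _ _ K (k, a))).
Qed.

Lemma ext_lactA a b x : ext_lact (a ∗ b) x = ext_lact a (ext_lact b x).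
Proof.
apply/pair_equal_spec; split; rewrite /= lactA// mlA.
by rewrite linearDr addrA.
Qed.

Lemma ext_ractA x a b : ext_ract x (a ∗ b) = ext_ract (ext_ract x a) b.
Proof.
apply/pair_equal_spec; split; rewrite /= ractA// mrA.
by rewrite linearDl addrA.
Qed.

Lemma ext_lractA a x b : ext_ract (ext_lact a x) b = ext_lact a (ext_ract x b).
Proof.
apply/pair_equal_spec; split; first exact: lractA.
by rewrite /= linearDl linearDr /= addrA mlrA lractA addrA.
Qed.

Definition extension : banachBimodule A :=
  @BanachBimodule R A (prod_banach Y K) ext_lact ext_ract
    ext_lact_continuous ext_ract_continuous ext_lactA ext_ractA ext_lractA.

End Extension.

(** * The section given by biprojectivity *)

Section Necessity.
Variables (R : realType) (A : banachAlgebra R).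

Lemma zero_bilinear (U V W : normedModType R[i]) :
  bilinear_for *:%R *:%R (fun (_ : U) (_ : V) => 0 : W).
Proof. by split=> x k u v; rewrite /= scaler0 addr0. Qed.

Definition zero_bilinear_map (U V W : normedModType R[i]) : {bilinear U -> V -> W} :=
  HB.pack (fun (_ : U) (_ : V) => 0 : W)
    (bilinear_isBilinear.Build R[i] U V W _ _ (fun _ _ => 0) (zero_bilinear U V W)).

Lemma zero_bilinear_continuous (U V W : normedModType R[i]) :
  continuous (fun q : U * V => zero_bilinear_map U V W q.1 q.2).
Proof. by move=> q; exact: cvg_cst. Qed.

Definition mul_or_zero (b : bool) : {bilinear A -> A -> A} :=
  if b then ba_mul A else zero_bilinear_map A A A.

Lemma mul_or_zero_continuous b : continuous (fun q : A * A => mul_or_zero b q.1 q.2).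
Proof.
by case: b; [exact: ba_mul_continuous|exact: zero_bilinear_continuous].
Qed.

Lemma mul_or_zero_lactA l a b x :
  mul_or_zero l (a ∗ b) x = mul_or_zero l a (mul_or_zero l b x).
Proof. by case: l => //=; rewrite ba_mulA. Qed.

Lemma mul_or_zero_ractA r x a b :
  mul_or_zero r x (a ∗ b) = mul_or_zero r (mul_or_zero r x a) b.
Proof. by case: r => //=; rewrite ba_mulA. Qed.

Lemma mul_or_zero_lractA l r a x b :
  mul_or_zero r (mul_or_zero l a x) b = mul_or_zero l a (mul_or_zero r x b).
Proof.
case: l r => -[] //=; rewrite ?ba_mulA//; first by rewrite linear0r.
by rewrite linear0l.
Qed.

(** These are the pieces of the extensions below: the coordinates u and v of the
augmentation ideal carry the structures (true, false) and (false, true), and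
(false, false) is the trivial bimodule. *)
Definition sided_bimodule (l r : bool) : banachBimodule A :=
  @BanachBimodule R A A (mul_or_zero l) (mul_or_zero r)
    (@mul_or_zero_continuous l) (@mul_or_zero_continuous r)
    (mul_or_zero_lactA l) (mul_or_zero_ractA r) (mul_or_zero_lractA l r).

Lemma linear_fst (U V : normedModType R[i]) : linear (@fst U V).
Proof. by []. Qed.

Section RankOne.
Variables (V W : normedModType R[i]) (h : {linear V -> R[i]^o}).

Definition rank_one (v : V) (w : W) : W := (h v : R[i]) *: w.

Lemma rank_one_bilinear : bilinear_for *:%R *:%R rank_one.
Proof.
split=> [x|a] k u v; rewrite /= /rank_one.
  by rewrite linearP scalerDl -scalerA.
by rewrite scalerDr !scalerA mulrC.
Qed.

HB.instance Definition _ :=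
  bilinear_isBilinear.Build R[i] V W W _ _ rank_one rank_one_bilinear.

Lemma rank_one_continuous : bounded_map h ->
  continuous (fun q : V * W => rank_one q.1 q.2).
Proof.
move=> [M M0 hM]; apply: (@bilinear_bounded_continuous _ _ _ _ rank_one M) => v w.
by rewrite rnormZ mulrA ler_wpM2r ?rnorm_ge0//; exact: hM.
Qed.
End RankOne.

(** The extension of A by A, both with zero actions, in which a sends (x, 0) to
(0, h(a) x) on the left. A lift of a |-> h(a) e sends e e both to
(0, h(e) h(e) e) and to 0. *)
Lemma functional_kills_products : biprojective A ->
  forall h : {linear A -> R[i]^o}, bounded_map h ->
  (forall a b, h (a ∗ b) = 0) -> forall a, h a = 0.
Proof.
move=> bipA h bh hmul e; apply/eqP/negP => /negP he0.
pose Y := sided_bimodule false false.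
pose ml : {bilinear A -> Y -> Y} := @rank_one A A h.
pose mr : {bilinear Y -> A -> Y} := zero_bilinear_map Y A Y.
have mlE a x : ml a x = (h a : R[i]) *: (x : A) by [].
have mlA a b y : ml (a ∗ b) y = ml a (lact Y b y) + lact Y a (ml b y).
  by rewrite !mlE hmul scale0r /= scaler0 addr0.
have mrA y a b : mr y (a ∗ b) = mr (ract Y y a) b + ract Y (mr y a) b.
  by rewrite /= addr0.
have mlrA a y b : mr (lact Y a y) b + ract Y (ml a y) b =
    ml a (ract Y y b) + lact Y a (mr y b).
  by rewrite /= mlE scaler0.
pose X := @extension R A Y Y ml mr (rank_one_continuous (W := A) bh)
  (@zero_bilinear_continuous Y A Y) mlA mrA mlrA.
have [sigma sigmaE] := @pack_linear R X Y (@fst A A) (@linear_fst A A).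
have lphi : linear (fun a : A => rank_one h a e).
  by move=> k u v; rewrite linearPl.
have [phi phiE] := @pack_linear R A A _ lphi.
have ls : linear (fun x : A => (x, 0) : X).
  by move=> k u v; apply/pair_equal_spec; split; rewrite /= ?scaler0 ?addr0.
have [s sE] := @pack_linear R Y X _ ls.
have sigma_epi : admissible_epimorphism sigma.
  split; first split.
  - by move=> x; rewrite (funext sigmaE); exact: cvg_fst.
  - by move=> a x; rewrite !sigmaE.
  - by move=> x a; rewrite !sigmaE.
  - by move=> y; exists (y, 0); rewrite sigmaE.
  - exists s => [y|y]; last by rewrite sigmaE sE.
    rewrite (funext sE); apply: cvg_pair; [exact: cvg_id|exact: cvg_cst].
have phi_mor : @bimodule_morphism R A (regular_bimodule A) Y phi.
  split.
  - apply/(@bounded_mapP R A A phi); have [M M0 hM] := bh.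
    exists (M * rnorm e) => [|a]; first by rewrite mulr_ge0 ?rnorm_ge0.
    by rewrite phiE rnormZ mulrAC ler_wpM2r ?rnorm_ge0//; exact: hM.
  - by move=> a x; rewrite phiE /rank_one /= hmul scale0r.
  - by move=> x a; rewrite phiE /rank_one /= hmul scale0r.
have [psi [_ psil psir] psiE] := bipA X Y sigma phi sigma_epi phi_mor.
have := congr1 snd (etrans (esym (psil e e)) (psir e e)).
rewrite /= !addr0 mlE.
have -> : (psi e).1 = rank_one h e e by rewrite -phiE -psiE sigmaE.
rewrite /rank_one => /eqP; rewrite !scaler_eq0 (negbTE he0) /= => /eqP e0.
by move: he0; rewrite e0 linear0 eqxx.
Qed.

(** A functional that does not vanish at a value f a reduces this to
[functional_kills_products]. Equivalently, the products span a dense subspace. *)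
Lemma map_kills_products : biprojective A ->
  forall f : {linear A -> A}, bounded_map f ->
  (forall a b, f (a ∗ b) = 0) -> forall a, f a = 0.
Proof.
move=> bipA f bf fmul a; apply/eqP/negP => /negP fa0.
have [g bg /negP] := nonzero_functional fa0; apply; apply/eqP.
have := @functional_kills_products bipA (g \o f) (bounded_comp bg bf).
by apply=> x y; rewrite /= fmul linear0.
Qed.

Local Notation T := (tensor_bimodule A).

(** The bimodule X is the augmentation ideal of the free bimodule: (u, v, w)
stands for u (x) 1 + 1 (x) v + w, with a unit adjoined. The left action puts
a (x) v into the last component, and symmetrically on the right. *)
Lemma biprojective_exact_section (p : {linear T -> A}) :
  tensor_square (@tens R A A : A -> A -> T) p -> biprojective A ->
  exists N : {linear A -> T},
    [/\ bounded_map N, forall a, p (N a) = a,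
        forall c a, N (c ∗ a) = lact T c (N a) &
        forall a c, N (a ∗ c) = ract T (N a) c].
Proof.
move=> tsq bipA.
pose Y1 := sided_bimodule true false; pose Y2 := sided_bimodule false true.
pose zl := zero_bilinear_map A Y1 Y2; pose zr := zero_bilinear_map Y1 A Y2.
have zlA a b y : zl (a ∗ b) y = zl a (lact Y1 b y) + lact Y2 a (zl b y).
  by rewrite /= addr0.
have zrA y a b : zr y (a ∗ b) = zr (ract Y1 y a) b + ract Y2 (zr y a) b.
  by rewrite /= linear0l addr0.
have zlrA a y b : zr (lact Y1 a y) b + ract Y2 (zl a y) b =
    zl a (ract Y1 y b) + lact Y2 a (zr y b).
  by rewrite /= linear0l.
(* The pairs (u, v). *)
pose Y := @extension R A Y1 Y2 zl zr (@zero_bilinear_continuous A Y1 Y2)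
  (@zero_bilinear_continuous Y1 A Y2) zlA zrA zlrA.
have lml : bilinear_for *:%R *:%R (fun (a : A) (y : Y) => tens a y.2 : T).
  split=> [y|a] k u v; first by rewrite linearPl.
  by rewrite linearPr.
have lmr : bilinear_for *:%R *:%R (fun (y : Y) (a : A) => tens y.1 a : T).
  split=> [a|y] k u v; first by rewrite linearPl.
  by rewrite linearPr.
have [ml mlE] := @pack_bilinear R A Y T _ lml.
have [mr mrE] := @pack_bilinear R Y A T _ lmr.
have ctens : continuous (fun q : A * A => tens q.1 q.2).
  apply: (@bilinear_bounded_continuous _ _ _ _ (@tens R A A) 1) => a b.
  by rewrite mul1r rnorm_tens.
have cml : continuous (fun q : A * Y => ml q.1 q.2).
  move=> [a y]; under eq_fun do rewrite mlE.
  have c1 : (fun q : A * Y => q.1) @ (a, y) --> a by exact: cvg_fst.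
  have c2 : (fun q : A * Y => q.2) @ (a, y) --> y by exact: cvg_snd.
  have c3 : (fun q : A * Y => q.2.2) @ (a, y) --> y.2.
    by apply: (cvg_comp _ _ c2); exact: cvg_snd.
  exact: (cvg_comp _ _ (cvg_pair c1 c3) (ctens (a, y.2))).
have cmr : continuous (fun q : Y * A => mr q.1 q.2).
  move=> [y a]; under eq_fun do rewrite mrE.
  have c1 : (fun q : Y * A => q.2) @ (y, a) --> a by exact: cvg_snd.
  have c2 : (fun q : Y * A => q.1) @ (y, a) --> y by exact: cvg_fst.
  have c3 : (fun q : Y * A => q.1.1) @ (y, a) --> y.1.
    by apply: (cvg_comp _ _ c2); exact: cvg_fst.
  exact: (cvg_comp _ _ (cvg_pair c3 c1) (ctens (y.1, a))).
have mlA a b y : ml (a ∗ b) y = ml a (lact Y b y) + lact T a (ml b y).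
  by rewrite !mlE /= addr0 linear0r add0r tensor_lact_tens.
have mrA y a b : mr y (a ∗ b) = mr (ract Y y a) b + ract T (mr y a) b.
  by rewrite !mrE /= linear0l add0r tensor_ract_tens.
have mlrA a y b : mr (lact Y a y) b + ract T (ml a y) b =
    ml a (ract Y y b) + lact T a (mr y b).
  by rewrite !mrE !mlE /= !add0r tensor_lact_tens tensor_ract_tens addrC.
pose X := @extension R A Y T ml mr cml cmr mlA mrA mlrA.
have bp : bounded_map p by exact: ts_prod_bounded tsq.
have lsigma : linear (fun x : X => x.1.1 + x.1.2 + p x.2 : A).
  move=> k u v; rewrite /= linearP !scalerDr.
  by rewrite [X in X + _ = _]addrACA [LHS]addrACA.
have [sigma sigmaE] := @pack_linear R X A _ lsigma.
have ls : linear (fun x : A => ((x, 0), 0) : X).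
  move=> k u v; apply/pair_equal_spec; split; last by rewrite /= scaler0 addr0.
  by apply/pair_equal_spec; split; rewrite /= ?scaler0 ?addr0.
have [s sE] := @pack_linear R A X _ ls.
have sigma_epi : @admissible_epimorphism R A X (regular_bimodule A) sigma.
  split; first split.
  - move=> x; rewrite (funext sigmaE).
    have c1 : (fun x : X => x.1) @ x --> x.1 by exact: cvg_fst.
    have c2 : (fun x : X => x.2) @ x --> x.2 by exact: cvg_snd.
    have c11 : (fun x : X => x.1.1) @ x --> x.1.1.
      by apply: (cvg_comp _ _ c1); exact: cvg_fst.
    have c12 : (fun x : X => x.1.2) @ x --> x.1.2.
      by apply: (cvg_comp _ _ c1); exact: cvg_snd.
    apply: cvgD; first exact: cvgD c11 c12.
    exact: (cvg_comp _ _ c2 (proj1 (bounded_mapP p) bp _)).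
  - move=> a x; rewrite !sigmaE /= mlE !addr0 linearD (ts_prod tsq).
    by rewrite [p _](ts_prod_lact tsq) !linearDr addrA.
  - move=> x a; rewrite !sigmaE /= mrE !add0r linearD (ts_prod tsq).
    by rewrite [p (tensor_ract _ _)](ts_prod_ract tsq) !linearDl addrCA addrA.
  - by move=> y; exists ((y, 0), 0); rewrite sigmaE /= linear0 !addr0.
  - exists s => [y|y]; last by rewrite sigmaE sE /= linear0 !addr0.
    rewrite (funext sE).
    have c1 : (fun x : A => (x, 0) : Y) @ y --> ((y, 0) : Y).
      by apply: cvg_pair; [exact: cvg_id|exact: cvg_cst].
    have c2 : (fun x : A => (0 : T)) @ y --> (0 : T) by exact: cvg_cst.
    exact: (cvg_pair c1 c2).
pose phi : {linear regular_bimodule A -> regular_bimodule A} := idfun.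
have phi_mor : bimodule_morphism phi.
  by split=> // x; exact: cvg_id.
have [psi [cpsi psil psir] psiE] :=
  bipA X (regular_bimodule A) sigma phi sigma_epi phi_mor.
have psil1 a b : psi (ba_mul A a b) = lact X a (psi b) := psil a b.
have psir1 a b : psi (ba_mul A a b) = ract X (psi a) b := psir a b.
have lu : linear (fun a : A => (psi a).1.1 : A) by move=> k a b; rewrite linearP.
have lv : linear (fun a : A => (psi a).1.2 : A) by move=> k a b; rewrite linearP.
have lw : linear (fun a : A => (psi a).2 : T) by move=> k a b; rewrite linearP.
have [u uE] := pack_linear lu; have [v vE] := pack_linear lv.
have [w wE] := pack_linear lw.
have c1 (a : A) : (fun b : A => (psi b).1) @ a --> (psi a).1.
  by apply: (cvg_comp _ _ (cpsi a)); exact: cvg_fst.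
have bu : bounded_map u.
  apply/bounded_mapP => a; rewrite (funext uE).
  by apply: (cvg_comp _ _ (c1 a)); exact: cvg_fst.
have bv : bounded_map v.
  apply/bounded_mapP => a; rewrite (funext vE).
  by apply: (cvg_comp _ _ (c1 a)); exact: cvg_snd.
have bw : bounded_map w.
  apply/bounded_mapP => a; rewrite (funext wE).
  by apply: (cvg_comp _ _ (cpsi a)); exact: cvg_snd.
have u0 : forall a, u a = 0.
  apply: map_kills_products => // a b.
  by rewrite uE psir1.
have v0 : forall a, v a = 0.
  apply: map_kills_products => // a b.
  by rewrite vE psil1 /= addr0.
exists w; split=> //.
- move=> a; have := psiE a; rewrite sigmaE -[(psi a).1.1]uE -[(psi a).1.2]vE.
  by rewrite u0 v0 !add0r wE.
- move=> c a; rewrite wE psil1 /= mlE -[(psi a).1.2]vE v0 linear0r add0r.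
  by rewrite wE.
- move=> a c; rewrite wE psir1 /= mrE -[(psi a).1.1]uE u0 linear0l add0r.
  by rewrite wE.
Qed.

End Necessity.

(** * The equivalence *)

Lemma opnorm0 (R : realType) (V W : normedModType R[i]) (f : V -> W) :
  (forall x, f x = 0) -> opnorm f = 0.
Proof.
move=> f0; rewrite /opnorm (_ : [set _ | _ in _] = [set 0]) ?sup1//.
apply/seteqP; split=> [_ [x _ <-]|_ ->] /=; first by rewrite f0 rnorm0.
by exists 0; rewrite /= ?f0 rnorm0.
Qed.

Definition one_point : directedSet :=
  @DirectedSet unit (fun _ _ => True) (fun _ => I) (fun _ _ _ _ _ => I)
    (fun i _ => ex_intro _ i (conj I I)) (inhabits tt).

Theorem corollary3p1 (R : realType) (A : banachAlgebra R) :
  biprojective A <->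
  exists (D : directedSet)
         (rho : D -> {linear regular_bimodule A -> tensor_bimodule A}),
    uniform_approx_morphism rho /\
    opnorm (fun a : A => product_map (rho nu a) - a) @[nu --> tails D] --> (0 : R).
Proof.
have tsq := projective_tensor_square A.
split=> [bipA|[D [rho [rhoM rhop]]]]; last first.
  apply: (exact_section_biprojective tsq); apply: (exact_section tsq).
  exact: approximate_section_bounds rhoM rhop.
have [N [bN pN Nl Nr]] := biprojective_exact_section tsq bipA.
pose rho (_ : one_point) : {linear regular_bimodule A -> tensor_bimodule A} := N.
exists one_point, rho; split; last first.
  rewrite (_ : (fun nu => _) = fun=> 0); first exact: cvg_cst.
  apply/funext => nu; apply: opnorm0 => a; apply/eqP; rewrite subr_eq0.
  by apply/eqP; exact: pN.
split=> [nu|S B _ _ eps eps0]; first by apply/bounded_mapP.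
exists tt => nu _ a x _ _; split.
- by rewrite (_ : _ - _ = 0) ?rnorm0//; apply/eqP; rewrite subr_eq0; apply/eqP/Nl.
- by rewrite (_ : _ - _ = 0) ?rnorm0//; apply/eqP; rewrite subr_eq0; apply/eqP/Nr.
Qed.
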